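(* Let $0<u_h<u$ be two precisions, let $A\in\mathbb{R}^{n\times n}$ be symmetric positive definite, and let $\widetilde Q\in\mathbb{R}^{n\times n}$ satisfy $\|\widetilde Q^T\widetilde Q-I\|_2\le p_1u<1/2$. Let $\widetilde A=\widetilde Q^TA\widetilde Q$, let $\widetilde A_{\mathrm{comp}}$ be its computed counterpart, and let $\widehat v_k(A)$ be the eigenvectors of $A$ computed by the mixed-precision preconditioned two-sided Jacobi algorithm described in the context. Let $\gamma_h=\frac{nu_h}{1-nu_h}<\gamma=\frac{nu}{1-nu}<1$. Assume that 1. $10n^{3/2}u(1-p_1u)^{-1}\kappa_2(A)<1$; 2. $\gamma_h<\dfrac{u(1-p_1u)}{16n^{1/2}\kappa_2(A)}$; 3. $14nu\,\kappa_2^S(\widetilde A)<1$; 4. the eigenvalues of $A$, of $\widetilde A$ and of $\widetilde A_{\mathrm{comp}}$ are simple and positive. Let $k\in\{1,\dots,n\}$ be such that $$p_1u\Big(1+\frac{2}{\operatorname{evrg}(A,k)}\Big)\le\frac12\qquad\text{and}\qquad 4n(1+p_1u)p_8u\le\operatorname{evrg}(A,k).$$ Then $$\sin\angle\big(v_k(A),\widehat v_k(A)\big)\le p_{10}u\left(1+\frac{\kappa_2^S(\widetilde A)}{\operatorname{evrg}(A,k)}\right),$$ where $p_{10}$ is a constant depending only on $n,p_1,p_5,p_8$ (and not on $A$, $\widetilde Q$, $u$, $u_h$ or $k$).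
   Context: **Notation.** $\lambda_1(B)\ge\lambda_2(B)\ge\cdots$ are the eigenvalues of a symmetric matrix $B$; $v_k(B)$ is an exact (unit) eigenvector associated with the $k$th largest eigenvalue. $\kappa_2(B)=\sigma_{\max}(B)/\sigma_{\min}(B)$. For symmetric positive definite $B=(b_{ij})$, $\kappa_2^S(B)=\kappa_2(DBD)$ with $D=\operatorname{diag}(b_{ii}^{-1/2})$. For symmetric positive definite $A$, $$\operatorname{evrg}(A,k)=\min_{j\ne k}\frac{|\lambda_k(A)-\lambda_j(A)|}{\sqrt{\lambda_k(A)\lambda_j(A)}}.$$ For nonzero vectors, $\angle(x,y)=\arccos\big(|x^Ty|/(\|x\|_2\|y\|_2)\big)\in[0,\pi/2]$. **Floating point.** ''At precision $w$'' means arithmetic in the standard model with unit roundoff $w$: each elementary operation satisfies $\mathrm{fl}(x\,\mathrm{op}\,y)=(x\,\mathrm{op}\,y)(1+\delta)$ with $|\delta|\le w$, and rounding (demoting) a number to precision $w$ incurs a relative error of at most $w$; no overflow or underflow occurs. **Algorithm** (mixed-precision preconditioned two-sided Jacobi). Input: symmetric $A\in\mathbb{R}^{n\times n}$, precisions $0<u_h<u$, and a preconditioner $\widetilde Q$ with $\|\widetilde Q^T\widetilde Q-I\|_2\le p_1u<1/2$. 1. Compute the product $\widetilde Q^TA\widetilde Q$ entirely at precision $u_h$, and demote the computed result to precision $u$; this gives the matrix $\widetilde A_{\mathrm{comp}}$, treated as symmetric. (The exact product is $\widetilde A=\widetilde Q^TA\widetilde Q$.) 2. Compute at precision $u$ a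 spectral decomposition $\widehat Q_J\widehat\Lambda_J\widehat Q_J^T$ of $\widetilde A_{\mathrm{comp}}$ by the two-sided Jacobi algorithm, eigenvalues ordered nonincreasingly. 3. Form the eigenvector matrix $\widetilde Q\widehat Q_J$ at precision $u$. Let $\widehat q_k(\widetilde A_{\mathrm{comp}})$ be the $k$th column of $\widehat Q_J$ (the computed eigenvector associated with the $k$th largest computed eigenvalue). The computed $k$th eigenvector of $A$ is $\widehat v_k(A)=\mathrm{fl}\big(\widetilde Q\,\widehat q_k(\widetilde A_{\mathrm{comp}})\big)$, i.e. the matrix–vector product formed at precision $u$. **The constants $p_5,p_7,p_8$.** $p_5$ and $p_7$ are the constants in the known backward error results for the two-sided Jacobi algorithm (run with its stopping criterion) used in step 2: there exist $\Delta\widetilde A_{\mathrm{comp}}$ and an orthogonal matrix $Q_J$ with $$\widetilde A_{\mathrm{comp}}+\Delta\widetilde A_{\mathrm{comp}}=Q_J\widehat\Lambda_JQ_J^T,\quad \|\Delta\widetilde A_{\mathrm{comp}}\|_2\le p_5u\|\widetilde A_{\mathrm{comp}}\|_2,\quad \|\widehat Q_J-Q_J\|_2\le p_5u,$$ $$|(\Delta\widetilde A_{\mathrm{comp}})_{ij}|\le p_7u\sqrt{(\widetilde A_{\mathrm{comp}})_{ii}(\widetilde A_{\mathrm{comp}})_{jj}}\quad\text{for all }i,j.$$ $p_8$ is a constant with $p_8\ge p_7+2p_7u+2$. *)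

(* Defs.v *)
From HB Require Import structures.
From mathcomp Require Import all_boot all_order all_algebra.
From mathcomp Require Import all_classical all_reals all_analysis.

Set Implicit Arguments.
Unset Strict Implicit.
Unset Printing Implicit Defensive.

Import Order.TTheory GRing.Theory Num.Theory.
Import numFieldNormedType.Exports.

Local Open Scope classical_set_scope.
Local Open Scope ring_scope.

Section Spectrum.
Variable R : realType.

(* Euclidean inner product and norm; the norm carried by matrices in
   MathComp-Analysis is the max norm. *)
Definition dot n (x y : 'cV[R]_n) : R := \sum_i x i 0 * y i 0.

Definition norm2 n (x : 'cV[R]_n) : R := Num.sqrt (dot x x).

Definition opnorm2 m n (B : 'M[R]_(m, n)) : R :=
  sup [set norm2 (B *m x) | x in [set x : 'cV[R]_n | norm2 x <= 1]].

Definition spd n (B : 'M[R]_n) : Prop :=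
  B^T = B /\ forall x : 'cV[R]_n, x != 0 -> 0 < dot x (B *m x).

(* The nonincreasing list of the eigenvalues of B, repeated according to
   their algebraic multiplicity. It is unique whenever the characteristic
   polynomial splits over R, in particular when B is symmetric. The value
   [::] for the other matrices is a dummy. *)
Definition eigvals n (B : 'M[R]_n) : seq R :=
  xget [::] [set s | sorted >=%R s /\ char_poly B = \prod_(x <- s) ('X - x%:P)].

(* lambda_(k+1)(B) in one-based numbering. *)
Definition eigval n (B : 'M[R]_n) (k : 'I_n) : R := nth 0 (eigvals B) k.

Definition simple_positive_spectrum n (B : 'M[R]_n) : Prop :=
  uniq (eigvals B) /\ forall x, x \in eigvals B -> 0 < x.

Definition unit_eigenvector n (B : 'M[R]_n) (k : 'I_n) (v : 'cV[R]_n) : Prop :=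
  B *m v = eigval B k *: v /\ norm2 v = 1.

Definition singvals n (B : 'M[R]_n) : seq R :=
  [seq Num.sqrt x | x <- eigvals (B^T *m B)].

Definition sigma_max n (B : 'M[R]_n) : R := head 0 (singvals B).
Definition sigma_min n (B : 'M[R]_n) : R := last 0 (singvals B).

Definition kappa2 n (B : 'M[R]_n) : R := sigma_max B / sigma_min B.

Definition kappa2S n (B : 'M[R]_n) : R :=
  let D := diag_mx (\row_i (Num.sqrt (B i i))^-1) in kappa2 (D *m B *m D).

(* Extended-real valued so that the minimum over the empty set, which only
   occurs for n = 1, is +oo (and its inverse is 0). *)
Definition evrg n (B : 'M[R]_n) (k : 'I_n) : \bar R :=
  \big[Order.min/+oo%E]_(j < n | j != k)
    (`|eigval B k - eigval B j| / Num.sqrt (eigval B k * eigval B j))%:E.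

Definition angle n (x y : 'cV[R]_n) : R :=
  acos (`|dot x y| / (norm2 x * norm2 y)).

End Spectrum.

Section FloatingPoint.
Variable R : realType.

(* Standard model with unit roundoff w: y is an admissible computed value of
   the exact quantity x. This also models demotion to precision w. *)
Definition rounded (w x y : R) : Prop :=
  exists d : R, `|d| <= w /\ y = x * (1 + d).

(* Admissible computed values of the sum of a nonempty list, the terms being
   added in any order and with any bracketing. *)
Inductive fl_sum (w : R) : seq R -> R -> Prop :=
| FlSum1 x : fl_sum w [:: x] x
| FlSumD s s1 s2 x1 x2 y :
    perm_eq s (s1 ++ s2) -> fl_sum w s1 x1 -> fl_sum w s2 x2 ->
    rounded w (x1 + x2) y -> fl_sum w s y.

Definition fl_mulmx (w : R) m n p
    (B : 'M[R]_(m, n)) (C : 'M[R]_(n, p)) (P : 'M[R]_(m, p)) : Prop :=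
  forall i j, exists t : 'I_n -> R,
    (forall l, rounded w (B i l * C l j) (t l)) /\ fl_sum w (codom t) (P i j).

Definition gamma_ (n : nat) (w : R) : R := n%:R * w / (1 - n%:R * w).

(* The triple product Qt^T A Qt at precision uh, with either association, then
   demoted to precision u. The computed product P need not be symmetric;
   treating the result as symmetric means that only one of the entries
   (i, j), (j, i) is used. If P is symmetric then Ac is just P demoted. *)
Definition computed_congruence n (u uh : R) (A Qt Ac : 'M[R]_n) : Prop :=
  exists Y P : 'M[R]_n,
    [/\ (fl_mulmx uh Qt^T A Y /\ fl_mulmx uh Y Qt P) \/
        (fl_mulmx uh A Qt Y /\ fl_mulmx uh Qt^T Y P),
        Ac^T = Ac
      & forall i j, rounded u (P i j) (Ac i j) \/ rounded u (P j i) (Ac i j)].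

(* The outcome (QJh, Lh) of the two-sided Jacobi algorithm run on Ac at
   precision u enters the analysis only through its backward error bounds;
   these bounds are what p5 and p7 stand for. *)
Definition jacobi_output n (p5 p7 u : R)
    (Ac QJh : 'M[R]_n) (Lh : 'rV[R]_n) : Prop :=
  (forall i j : 'I_n, (i <= j)%N -> Lh 0 j <= Lh 0 i) /\
  exists DA QJ : 'M[R]_n,
    [/\ QJ^T *m QJ = 1%:M,
        Ac + DA = QJ *m diag_mx Lh *m QJ^T,
        opnorm2 DA <= p5 * u * opnorm2 Ac,
        opnorm2 (QJh - QJ) <= p5 * u
      & forall i j, `|DA i j| <= p7 * u * Num.sqrt (Ac i i * Ac j j)].

End FloatingPoint.

(* Main.v *)
Require Import Defs.
From HB Require Import structures.
From mathcomp Require Import all_boot all_order all_algebra.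
From mathcomp Require Import all_classical all_reals all_analysis.
From mathcomp Require Import complex.
From mathcomp Require Import ring lra.

Set Implicit Arguments.
Unset Strict Implicit.
Unset Printing Implicit Defensive.

Import Order.TTheory GRing.Theory Num.Theory.
Import numFieldNormedType.Exports.

Local Open Scope ring_scope.

(** The sine never exceeds 1, so the bound is trivial once [p10 u (1 + kappa / g)]
    reaches 1, where [kappa] is the scaled condition number of
    [At = Qt^T A Qt] and [g] the relative gap of [A] at [k]. With [p10] large,
    both [u] and [u kappa / g] may therefore be taken as small as desired in
    terms of [n], [p1], [p5] and [p8].

    The rounding errors of the congruence and the backward error of the Jacobi
    algorithm combine: the computed decomposition [QJ diag(Lh) QJ^T] is exact for
    [At + F], where [|F_ij| <= c u sqrt(At_ii At_jj)] ([backward_error_scaled]).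
    The errors made at precision [uh] fit this form because [uh] is below
    [u / kappa2(A)], up to a constant. Such an [F] obeys two bounds
    ([perturbation_forms]): relative to the quadratic form of [At], with the
    factor [n c u kappa], and absolute, with the factor [2 n c u ||A||], which is
    at most a constant times the smallest eigenvalue of [A].

    Let [q] be the [k]th column of [QJ], with eigenvalue [mu], and let [a] be an
    eigenvector of [A] for another eigenvalue [al]. Writing [a = Qt b] and testing
    [(At + F) q = mu q] against [b] gives
      [(al - mu) (a . Qt q) = - mu (b . (Qt^T Qt - 1) q) - b . F q],
    which bounds the components of [Qt q] off [v_k(A)] without passing through the
    eigenvectors of [At] ([perturbed_coordinate]). The denominator is controlled
    by Weyl inequalities for [mu], obtained by comparing the forms of [At + F]
    and of [A] through [Qt] ([weyl_le], [weyl_ge]). If [g] is large, the absolute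
    bound on [F] is small compared with the distance of the [k]th eigenvalue to
    the others; if [g] is bounded, smallness of [u kappa / g] makes the relative
    bound small ([perturbed_eigenvalue]). Finally the computed vector differs from
    [Qt q] by a multiple of [u] ([computed_product_err]). *)

(** * Euclidean geometry of column vectors *)

Section Euclid.
Variable R : realType.
Implicit Type n : nat.

Lemma dotE n (x y : 'cV[R]_n) : dot x y = (x^T *m y) 0 0.
Proof. by rewrite mxE; apply: eq_bigr => i _; rewrite mxE. Qed.

Lemma dotC n (x y : 'cV[R]_n) : dot x y = dot y x.
Proof. by apply: eq_bigr => i _; rewrite mulrC. Qed.

Lemma dotDr n (x y z : 'cV[R]_n) : dot x (y + z) = dot x y + dot x z.
Proof. by rewrite -big_split; apply: eq_bigr => i _; rewrite mxE mulrDr. Qed.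

Lemma dotNr n (x y : 'cV[R]_n) : dot x (- y) = - dot x y.
Proof. by rewrite -sumrN; apply: eq_bigr => i _; rewrite mxE mulrN. Qed.

Lemma dotBr n (x y z : 'cV[R]_n) : dot x (y - z) = dot x y - dot x z.
Proof. by rewrite dotDr dotNr. Qed.

Lemma dotZr n a (x y : 'cV[R]_n) : dot x (a *: y) = a * dot x y.
Proof. by rewrite /dot mulr_sumr; apply: eq_bigr => i _; rewrite mxE mulrCA. Qed.

Lemma dotDl n (x y z : 'cV[R]_n) : dot (x + y) z = dot x z + dot y z.
Proof. by rewrite !(dotC _ z) dotDr. Qed.

Lemma dotBl n (x y z : 'cV[R]_n) : dot (x - y) z = dot x z - dot y z.
Proof. by rewrite !(dotC _ z) dotBr. Qed.

Lemma dotZl n a (x y : 'cV[R]_n) : dot (a *: x) y = a * dot x y.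
Proof. by rewrite !(dotC _ y) dotZr. Qed.

Lemma dot_trmx m n (B : 'M[R]_(m, n)) x y : dot (B^T *m x) y = dot x (B *m y).
Proof. by rewrite !dotE trmx_mul trmxK mulmxA. Qed.

Lemma dot_ge0 n (x : 'cV[R]_n) : 0 <= dot x x.
Proof. by apply: sumr_ge0 => i _; rewrite -expr2 sqr_ge0. Qed.

Lemma dot_eq0 n (x : 'cV[R]_n) : (dot x x == 0) = (x == 0).
Proof.
apply/idP/eqP => [|->]; last by rewrite dotE mulmx0 mxE.
rewrite psumr_eq0 => [/allP h|i _]; last by rewrite -expr2 sqr_ge0.
apply/colP => i; rewrite mxE.
by have /implyP/(_ isT) := h i (mem_index_enum _); rewrite -expr2 sqrf_eq0 => /eqP.
Qed.

Lemma dot_gt0 n (x : 'cV[R]_n) : x != 0 -> 0 < dot x x.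
Proof. by move=> x0; rewrite lt_def dot_eq0 x0 dot_ge0. Qed.

(** The discriminant argument, applied to [c *: x - b *: y]; when the form
    degenerates at [y] one lets a multiple of [y] go to infinity instead. *)
Lemma psd_cauchy_schwarz n (B : 'M[R]_n) x y :
    B^T = B -> (forall z, 0 <= dot z (B *m z)) ->
  dot x (B *m y) ^+ 2 <= dot x (B *m x) * dot y (B *m y).
Proof.
move=> Bsym Bge0.
have Byx : dot y (B *m x) = dot x (B *m y) by rewrite -dot_trmx Bsym dotC.
have quad s t : 0 <= s ^+ 2 * dot x (B *m x) + 2 * s * t * dot x (B *m y)
    + t ^+ 2 * dot y (B *m y).
  have := Bge0 (s *: x + t *: y).
  rewrite mulmxDr -!scalemxAr dotDl !dotDr !dotZl !dotZr Byx => h.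
  by apply: le_trans h _; rewrite le_eqVlt; apply/orP; left; apply/eqP; ring.
set a := dot x _ in quad *; set b := dot x _ in quad *; set c := dot y _ in quad *.
have a0 : 0 <= a := Bge0 x.
have := Bge0 y; rewrite -/c le_eqVlt => /orP[/eqP c0|c0].
  have [->|b0] := eqVneq b 0; first by rewrite expr0n /= -c0 mulr0.
  have := quad 1 (- (a + 1) / (2 * b)); rewrite -c0 mulr0 addr0 expr1n mul1r mulr1.
  have -> : 2 * (- (a + 1) / (2 * b)) * b = - (a + 1) by field.
  lra.
have := quad c (- b).
have -> : c ^+ 2 * a + 2 * c * - b * b + (- b) ^+ 2 * c = c * (a * c - b ^+ 2) by ring.
by rewrite pmulr_rge0 // subr_ge0.
Qed.

Lemma cauchy_schwarz n (x y : 'cV[R]_n) : dot x y ^+ 2 <= dot x x * dot y y.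
Proof.
have := @psd_cauchy_schwarz n 1%:M x y; rewrite !mul1mx trmx1; apply=> // z.
by rewrite mul1mx dot_ge0.
Qed.

Lemma norm2_ge0 n (x : 'cV[R]_n) : 0 <= norm2 x.
Proof. exact: sqrtr_ge0. Qed.

Lemma sqr_norm2 n (x : 'cV[R]_n) : norm2 x ^+ 2 = dot x x.
Proof. by rewrite sqr_sqrtr // dot_ge0. Qed.

Lemma norm2_eq0 n (x : 'cV[R]_n) : (norm2 x == 0) = (x == 0).
Proof. by rewrite -dot_eq0 -sqr_norm2 sqrf_eq0. Qed.

Lemma norm2_0 n : norm2 (0 : 'cV[R]_n) = 0.
Proof. by apply/eqP; rewrite norm2_eq0. Qed.

Lemma norm2_gt0 n (x : 'cV[R]_n) : x != 0 -> 0 < norm2 x.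
Proof. by rewrite lt_def norm2_eq0 norm2_ge0 => ->. Qed.

Lemma abs_dot_le n (x y : 'cV[R]_n) : `|dot x y| <= norm2 x * norm2 y.
Proof.
rewrite -ler_sqr ?nnegrE ?mulr_ge0 ?norm2_ge0 //.
by rewrite real_normK ?num_real // exprMn !sqr_norm2 cauchy_schwarz.
Qed.

Lemma norm2Z n a (x : 'cV[R]_n) : norm2 (a *: x) = `|a| * norm2 x.
Proof. by rewrite /norm2 dotZl dotZr mulrA -expr2 sqrtrM ?sqr_ge0 // sqrtr_sqr. Qed.

Lemma norm2D n (x y : 'cV[R]_n) : norm2 (x + y) <= norm2 x + norm2 y.
Proof.
rewrite -ler_sqr ?nnegrE ?addr_ge0 ?norm2_ge0 //.
rewrite sqrrD !sqr_norm2 dotDl !dotDr (dotC y x).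
by have := ler_norm (dot x y); have := abs_dot_le x y; lra.
Qed.

Lemma norm2N n (x : 'cV[R]_n) : norm2 (- x) = norm2 x.
Proof. by rewrite -scaleN1r norm2Z normrN1 mul1r. Qed.

Lemma norm2B n (x y : 'cV[R]_n) : norm2 (x - y) <= norm2 x + norm2 y.
Proof. by rewrite -(norm2N y) norm2D. Qed.

Lemma abs_coord_le n (x : 'cV[R]_n) i : `|x i 0| <= norm2 x.
Proof.
rewrite -ler_sqr ?nnegrE ?norm2_ge0 // real_normK ?num_real // sqr_norm2.
rewrite /dot (bigD1 i) //= expr2 lerDl.
by apply: sumr_ge0 => j _; rewrite -expr2 sqr_ge0.
Qed.

Lemma sqr_sum_le n (f : 'I_n -> R) : (\sum_i f i) ^+ 2 <= n%:R * \sum_i f i ^+ 2.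
Proof.
have := cauchy_schwarz (const_mx 1 : 'cV[R]_n) (\col_i f i).
rewrite /dot; under eq_bigr do rewrite !mxE mul1r.
under [X in _ <= X * _]eq_bigr do rewrite !mxE mul1r.
under [X in _ <= _ * X]eq_bigr do rewrite !mxE -expr2.
by rewrite sumr_const card_ord.
Qed.

Lemma norm2_le_bound n (x : 'cV[R]_n) b :
  0 <= b -> (forall i, `|x i 0| <= b) -> norm2 x <= n%:R * b.
Proof.
move=> b0 xb; rewrite -ler_sqr ?nnegrE ?norm2_ge0 ?mulr_ge0 // sqr_norm2.
apply: (@le_trans _ _ (\sum_(i < n) b ^+ 2)).
  apply: ler_sum => i _; rewrite -expr2 -real_normK ?num_real //.
  by rewrite ler_sqr ?nnegrE.
rewrite sumr_const card_ord -[_ *+ n]mulr_natl exprMn ler_wpM2r ?sqr_ge0 //.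
by case: (n) => [|m]; rewrite ?expr0n // expr2 -natrM ler_nat mulSn leq_addr.
Qed.

(** Finiteness of the supremum that defines the operator norm. *)
Lemma mulmx_bounded m n (B : 'M[R]_(m, n)) :
  exists2 b : R, 0 <= b & forall x, norm2 (B *m x) <= b * norm2 x.
Proof.
pose s := \sum_i \sum_j `|B i j|.
have s0 : 0 <= s by apply: sumr_ge0 => i _; apply: sumr_ge0.
exists (m%:R * s); first exact: mulr_ge0.
move=> x; rewrite -mulrA; apply: norm2_le_bound => [|i].
  by rewrite mulr_ge0 ?norm2_ge0.
rewrite mxE; apply: le_trans (ler_norm_sum _ _ _) _.
apply: (@le_trans _ _ ((\sum_j `|B i j|) * norm2 x)).
  rewrite mulr_suml; apply: ler_sum => j _.
  by rewrite normrM ler_wpM2l // abs_coord_le.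
rewrite ler_wpM2r ?norm2_ge0 // /s (bigD1 i) //= lerDl.
by apply: sumr_ge0 => k _; apply: sumr_ge0.
Qed.

Lemma opnorm2_ub m n (B : 'M[R]_(m, n)) :
  has_sup [set norm2 (B *m x) | x in [set x : 'cV[R]_n | norm2 x <= 1]]%classic.
Proof.
split; first by exists (norm2 (B *m 0)), 0 => //=; rewrite norm2_0.
have [b b0 Bb] := mulmx_bounded B.
exists b => _ [x /= x1 <-]; apply: le_trans (Bb x) _.
by rewrite ler_piMr.
Qed.

Lemma opnorm2_ge0 m n (B : 'M[R]_(m, n)) : 0 <= opnorm2 B.
Proof.
apply: le_trans (norm2_ge0 (B *m 0)) _; apply: sup_upper_bound (opnorm2_ub B) _ _.
by exists 0 => //=; rewrite norm2_0.
Qed.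

Lemma norm2_mulmx_le m n (B : 'M[R]_(m, n)) x :
  norm2 (B *m x) <= opnorm2 B * norm2 x.
Proof.
have [->|x0] := eqVneq x 0; first by rewrite mulmx0 !norm2_0 mulr0.
have nx := norm2_gt0 x0.
rewrite -ler_pdivrMr //; apply: sup_upper_bound (opnorm2_ub B) _ _ => /=.
exists ((norm2 x)^-1 *: x) => /=.
  by rewrite norm2Z ger0_norm ?invr_ge0 ?norm2_ge0 // mulVf ?gt_eqF.
by rewrite -scalemxAr norm2Z ger0_norm ?invr_ge0 ?norm2_ge0 // mulrC.
Qed.

Lemma dot_delta_mx n (B : 'M[R]_n) i j :
  dot (delta_mx i 0) (B *m delta_mx j 0) = B i j.
Proof. by rewrite -colE dotE trmx_delta -rowE !mxE. Qed.

Lemma dot_delta n (j : 'I_n) : dot (delta_mx j 0) (delta_mx j 0 : 'cV[R]_n) = 1.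
Proof. by rewrite -{2}[delta_mx _ _]mul1mx dot_delta_mx mxE eqxx. Qed.

Lemma norm2_delta n (j : 'I_n) : norm2 (delta_mx j 0 : 'cV[R]_n) = 1.
Proof. by rewrite /norm2 dot_delta sqrtr1. Qed.

Lemma entry_le_norm_col m n (B : 'M[R]_(m, n)) i j :
  `|B i j| <= norm2 (B *m delta_mx j 0).
Proof. by rewrite -colE; have := abs_coord_le (col j B) i; rewrite mxE. Qed.

Lemma coord_trmx m n (V : 'M[R]_(m, n)) x j : (V^T *m x) j 0 = dot (col j V) x.
Proof. by rewrite mxE; apply: eq_bigr => i _; rewrite !mxE. Qed.

Lemma orthogonal_isometry n (V : 'M[R]_n) x :
  V^T *m V = 1%:M -> dot (V *m x) (V *m x) = dot x x.
Proof. by move=> VV; rewrite -dot_trmx mulmxA VV mul1mx. Qed.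

Lemma dot_col_orthogonal n (V : 'M[R]_n) j :
  V^T *m V = 1%:M -> dot (col j V) (col j V) = 1.
Proof. by move=> VV; rewrite colE orthogonal_isometry // dot_delta. Qed.

Lemma col_eigenvector n (V : 'M[R]_n) (a : 'rV[R]_n) j : V^T *m V = 1%:M ->
  (V *m diag_mx a *m V^T) *m col j V = a 0 j *: col j V.
Proof.
move=> VV; rewrite colE -!mulmxA [V^T *m _]mulmxA VV mul1mx scalemxAr.
congr (_ *m _); apply/colP => i; rewrite mul_diag_mx !mxE.
by case: eqP => [->|]; rewrite ?mulr0 ?andbF.
Qed.

(** Fewer than [n] homogeneous linear conditions on [n] unknowns. *)
Lemma nontrivial_solution n (r : 'M[R]_n) k :
  exists2 x : 'cV[R]_n, x != 0 & forall j, j != k -> (r *m x) j 0 = 0.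
Proof.
pose r0 := \matrix_(i, j) (if i == k then 0 else r i j).
have : \det r0^T = 0.
  rewrite det_tr (expand_det_row _ k) big1 // => j _.
  by rewrite mxE eqxx mul0r.
move/eqP/det0P => [y y0 yr]; exists y^T; first by rewrite trmx_eq0.
move=> j jk; have /rowP/(_ j) := yr; rewrite [in RHS]mxE => yrj.
rewrite -[RHS]yrj !mxE; apply: eq_bigr => i _.
by rewrite !mxE (negPf jk) mulrC.
Qed.

End Euclid.

(** * Spectra of real symmetric matrices *)

Section Spectral.
Variable R : realType.
Implicit Type n : nat.

Lemma char_poly_similar (F : fieldType) n (P D : 'M[F]_n) :
  P \in unitmx -> char_poly (invmx P *m D *m P) = char_poly D.
Proof.
move=> Pu; rewrite /char_poly.
have -> : char_poly_mx (invmx P *m D *m P) =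
    map_mx polyC (invmx P) *m char_poly_mx D *m map_mx polyC P.
  rewrite /char_poly_mx mulmxBr mulmxBl -!map_mxM /=; congr (_ - _).
  by rewrite scalar_mxC -mulmxA -map_mxM mulVmx // map_mx1 mulmx1.
by rewrite !det_mulmx mulrAC -det_mulmx -map_mxM mulVmx // map_mx1 det1 mul1r.
Qed.

(** The spectral theorem over [R[i]], read off on real vectors: the weights
    [y j] are the squared moduli of the coordinates of [x] in a unitary
    eigenbasis, so that the real quadratic form is controlled without having to
    find real eigenvectors. *)
Lemma symmetric_spectrum n (B : 'M[R]_n) : B^T = B ->
  exists d : 'I_n -> R, char_poly B = \prod_j ('X - (d j)%:P) /\
  forall x : 'cV[R]_n, exists y : 'I_n -> R,
  [/\ forall j, 0 <= y j, dot x x = \sum_j y j & dot x (B *m x) = \sum_j d j * y j].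
Proof.
move=> Bsym; pose f := real_complex R : {rmorphism R -> R[i]}.
pose BC := map_mx f B.
have BCreal : BC \is a mxOver Num.real.
  apply/mxOverP => i j; rewrite mxE; apply/complex_realP.
  by exists (B i j).
have BCherm : BC \is hermsymmx.
  apply: realsym_hermsym => //; apply/is_hermitianmxP.
  by rewrite expr0 scale1r map_mx_id // /BC map_trmx Bsym.
have /orthomx_spectralP BE := hermitian_normalmx BCherm.
have Dreal := hermitian_spectral_diag_real BCherm.
have PU := spectral_unitarymx BC; have Pu := spectral_unit BC.
rewrite invmx_unitary // in BE.
move: Dreal PU Pu BE; set P := spectralmx BC; set D := spectral_diag BC.
move=> Dreal PU Pu BE.
pose d j := complex.Re (D 0 j).
have dE j : f (d j) = D 0 j.
  have /mxOverP/(_ 0 j)/complex_realP[a Da] := Dreal.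
  by rewrite /d Da.
exists d; split.
  apply: (map_poly_inj f); rewrite map_char_poly -/BC.
  have := char_poly_similar (diag_mx D) Pu; rewrite invmx_unitary // -BE => ->.
  rewrite char_poly_trig ?diag_mx_is_trig // rmorph_prod.
  apply: eq_bigr => j _.
  by rewrite rmorphB /= map_polyX map_polyC /= dE mxE eqxx mulr1n.
move=> x; have [z zx] : exists z, z = P *m map_mx f x by exists (P *m map_mx f x).
pose y j := complex.Re (z j 0) ^+ 2 + complex.Im (z j 0) ^+ 2.
have yE j : f (y j) = Num.conj (z j 0) * z j 0.
  rewrite /y; case: (z j 0) => a b; apply/eqP; rewrite eq_complex /=.
  by apply/andP; split; apply/eqP; ring.
have xr : (map_mx f x)^T = map_mx Num.conj (map_mx f x)^T.
  apply/matrixP => i j; rewrite !mxE; apply/esym/CrealP/complex_realP.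
  by exists (x j i).
have zE (G : 'M[R[i]]_n) : map_mx Num.conj z^T *m G *m z =
    (map_mx f x)^T *m (map_mx Num.conj P^T *m G *m P) *m map_mx f x.
  by rewrite [in RHS]xr zx trmx_mul map_mxM /= !mulmxA.
exists y; split.
- by move=> j; rewrite addr_ge0 ?sqr_ge0.
- apply: (fmorph_inj f); rewrite dotE rmorph_sum.
  have := zE 1%:M; rewrite !mulmx1.
  rewrite -invmx_unitary // mulVmx // mulmx1 => /matrixP/(_ 0 0).
  rewrite mxE; under eq_bigr do rewrite !mxE -yE.
  by rewrite map_trmx -map_mxM mxE => ->.
- apply: (fmorph_inj f); rewrite dotE rmorph_sum.
  have := zE (diag_mx D); rewrite -BE => /matrixP/(_ 0 0).
  rewrite map_trmx -!map_mxM [RHS]mxE mulmxA => <-.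
  rewrite mxE; apply: eq_bigr => j _.
  by rewrite mul_mx_diag !mxE rmorphM dE yE /= mulrAC mulrC.
Qed.

Lemma eigvals_spec n (B : 'M[R]_n) : B^T = B ->
  sorted >=%R (eigvals B) /\ char_poly B = \prod_(x <- eigvals B) ('X - x%:P).
Proof.
move=> Bsym; have [d [dB _]] := symmetric_spectrum Bsym.
rewrite /eigvals; apply: (@xgetPex _ [::]
  [set s | sorted >=%R s /\ char_poly B = \prod_(x <- s) ('X - x%:P)]%classic).
exists (sort >=%R (codom d)); split.
  by apply: sort_sorted => a b; apply: le_total.
by rewrite dB (perm_big _ (permEl (perm_sort _ _))) big_image.
Qed.

Lemma size_eigvals n (B : 'M[R]_n) : B^T = B -> size (eigvals B) = n.
Proof.
move=> /eigvals_spec[_ /(congr1 (fun p : {poly R} => size p))].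
by rewrite size_char_poly size_prod_XsubC => -[].
Qed.

Lemma mem_eigval n (B : 'M[R]_n) j : B^T = B -> eigval B j \in eigvals B.
Proof. by move=> Bsym; rewrite mem_nth // size_eigvals. Qed.

Lemma eigval_nonincr n (B : 'M[R]_n) (i j : 'I_n) :
  B^T = B -> (i <= j)%N -> eigval B j <= eigval B i.
Proof.
move=> Bsym ij; have [Bs _] := eigvals_spec Bsym.
by apply: (sorted_leq_nth ge_trans le_refl 0 Bs); rewrite ?inE ?size_eigvals.
Qed.

Lemma eigvals_range n (B : 'M[R]_n) x : B^T = B -> x \in eigvals B ->
  last 0 (eigvals B) <= x <= head 0 (eigvals B).
Proof.
move=> Bsym xB; have [Bs _] := eigvals_spec Bsym.
rewrite -nth_last -nth0 -(nth_index 0 xB).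
have xs : (index x (eigvals B) < size (eigvals B))%N by rewrite index_mem.
have s0 : (0 < size (eigvals B))%N by exact: leq_ltn_trans xs.
by apply/andP; split; apply: (sorted_leq_nth ge_trans le_refl 0 Bs);
  rewrite ?inE ?prednK // -ltnS prednK.
Qed.

Lemma rayleigh_bounds n (B : 'M[R]_n) x : B^T = B ->
  last 0 (eigvals B) * dot x x <= dot x (B *m x) <= head 0 (eigvals B) * dot x x.
Proof.
move=> Bsym; have [d [dB /(_ x)[y [y0 -> ->]]]] := symmetric_spectrum Bsym.
have [_ BE] := eigvals_spec Bsym.
have dmem j : d j \in eigvals B.
  by rewrite -root_prod_XsubC -BE dB /root horner_prod prodf_seq_eq0;
     apply/hasP; exists j; rewrite ?mem_index_enum //= !hornerE subrr.
rewrite !mulr_sumr; apply/andP; split; apply: ler_sum => j _;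
  by have /andP[lo hi] := eigvals_range Bsym (dmem j); apply: ler_wpM2r.
Qed.

Lemma eigvals_root n (B : 'M[R]_n) x : B^T = B -> x \in eigvals B ->
  exists2 v : 'cV[R]_n, B *m v = x *: v & norm2 v = 1.
Proof.
move=> Bsym; have [_ BE] := eigvals_spec Bsym.
rewrite -root_prod_XsubC -BE -eigenvalue_root_char => /eigenvalueP[w wB w0].
have nw : norm2 w^T != 0 by rewrite norm2_eq0 trmx_eq0.
exists ((norm2 w^T)^-1 *: w^T).
  rewrite -scalemxAr -{1}Bsym -trmx_mul wB scalerA mulrC -scalerA.
  by rewrite linearZ.
by rewrite norm2Z ger0_norm ?invr_ge0 ?norm2_ge0 // mulVf.
Qed.

End Spectral.

(** * Condition numbers of positive definite matrices *)

Section Condition.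
Variable R : realType.
Implicit Type n : nat.

Lemma spd_psd n (S : 'M[R]_n) x : spd S -> 0 <= dot x (S *m x).
Proof.
move=> [_ Spos]; have [->|/Spos/ltW//] := eqVneq x 0.
by rewrite mulmx0 dotE mulmx0 mxE.
Qed.

Lemma spd_unit n (S : 'M[R]_n) : spd S -> S \in unitmx.
Proof.
move=> [Ssym Spos]; rewrite unitmxE unitfE; apply/det0P => -[v v0 vS].
have := Spos v^T; rewrite trmx_eq0 => /(_ v0).
by rewrite -{1}Ssym -trmx_mul vS trmx0 dotE mulmx0 mxE ltxx.
Qed.

Lemma sigma_min_eq n (S : 'M[R]_n) : sigma_min S = Num.sqrt (last 0 (eigvals (S^T *m S))).
Proof. by rewrite /sigma_min /singvals -[in LHS](sqrtr0 R) last_map. Qed.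

Lemma sigma_max_eq n (S : 'M[R]_n) : sigma_max S = Num.sqrt (head 0 (eigvals (S^T *m S))).
Proof.
by rewrite /sigma_max /singvals; case: eigvals => //=; rewrite sqrtr0.
Qed.

Lemma sigma_bounds n (S : 'M[R]_n) (n_gt0 : (0 < n)%N) : spd S ->
  [/\ 0 < sigma_min S, sigma_min S <= sigma_max S,
      forall x, sigma_min S * norm2 x <= norm2 (S *m x)
    & forall x, norm2 (S *m x) <= sigma_max S * norm2 x].
Proof.
move=> Sspd; have Su := spd_unit Sspd.
set B := S^T *m S; have Bsym : B^T = B by rewrite trmx_mul trmxK.
have quad x : dot x (B *m x) = dot (S *m x) (S *m x).
  by rewrite -mulmxA -dot_trmx trmxK.
have pos l : l \in eigvals B -> 0 < l.
  move=> /(eigvals_root Bsym)[v Bv v1].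
  have vv : dot v v = 1 by rewrite -sqr_norm2 v1 expr1n.
  have := quad v; rewrite Bv dotZr vv mulr1 => ->.
  apply: dot_gt0; apply/eqP => Sv0.
  move: v1; rewrite -(mulKmx Su v) Sv0 mulmx0 norm2_0 => /esym/eqP.
  by rewrite oner_eq0.
have lastin : last 0 (eigvals B) \in eigvals B.
  by rewrite -nth_last mem_nth // size_eigvals // prednK.
have l0 := pos _ lastin.
have /andP[_ lh] := eigvals_range Bsym lastin.
have bnd x : last 0 (eigvals B) * norm2 x ^+ 2 <= norm2 (S *m x) ^+ 2
    <= head 0 (eigvals B) * norm2 x ^+ 2.
  by rewrite !sqr_norm2 -quad rayleigh_bounds.
rewrite sigma_min_eq sigma_max_eq -/B; split=> [||x|x].
- by rewrite sqrtr_gt0.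
- by rewrite ler_sqrt // (le_trans _ lh) // ltW.
- rewrite -ler_sqr ?nnegrE ?mulr_ge0 ?sqrtr_ge0 // exprMn (sqr_sqrtr (ltW l0)).
  by case/andP: (bnd x).
- rewrite -ler_sqr ?nnegrE ?mulr_ge0 ?sqrtr_ge0 // exprMn.
  rewrite (sqr_sqrtr (le_trans (ltW l0) lh)).
  by case/andP: (bnd x).
Qed.

(** The lower bound is Cauchy-Schwarz for the form of [S], applied to [x] and
    [S^-1 x]; it avoids comparing the spectra of [S] and of its square. *)
Lemma spd_quad_bounds n (S : 'M[R]_n) x (n_gt0 : (0 < n)%N) : spd S ->
  sigma_min S * dot x x <= dot x (S *m x) <= sigma_max S * dot x x.
Proof.
move=> Sspd; have [m0 mM lo hi] := sigma_bounds n_gt0 Sspd.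
have [->|x0] := eqVneq x 0; first by rewrite mulmx0 !(dotE 0) !mulmx0 mxE !mulr0 lexx.
apply/andP; split; last first.
  apply: le_trans (ler_norm _) _; apply: le_trans (abs_dot_le _ _) _.
  by rewrite -sqr_norm2 expr2 mulrCA ler_wpM2l ?norm2_ge0.
have [Ssym _] := Sspd; have Su := spd_unit Sspd.
pose y := invmx S *m x; have Sy : S *m y = x by rewrite mulKVmx.
have := psd_cauchy_schwarz x y Ssym (fun z => spd_psd z Sspd).
rewrite Sy => cs; have yx : sigma_min S * dot y x <= dot x x.
  have := lo y; rewrite Sy => loy.
  apply: (@le_trans _ _ (sigma_min S * (norm2 y * norm2 x))).
    by rewrite ler_wpM2l ?(ltW m0) // (le_trans (ler_norm _)) ?abs_dot_le.
  by rewrite mulrA -sqr_norm2 expr2 ler_wpM2r ?norm2_ge0.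
have xx := dot_gt0 x0.
rewrite -(ler_pM2r xx) -mulrA -expr2.
apply: (@le_trans _ _ (sigma_min S * (dot x (S *m x) * dot y x))).
  by rewrite ler_wpM2l ?(ltW m0).
by rewrite mulrCA ler_wpM2l // spd_psd.
Qed.

Lemma spd_entry_le n (S : 'M[R]_n) i j (n_gt0 : (0 < n)%N) :
  spd S -> `|S i j| <= sigma_max S.
Proof.
move=> Sspd; have [_ _ _ hi] := sigma_bounds n_gt0 Sspd.
apply: le_trans (entry_le_norm_col _ _ _) _.
by have := hi (delta_mx j 0); rewrite norm2_delta mulr1.
Qed.

Lemma spd_diag_gt0 n (S : 'M[R]_n) i : spd S -> 0 < S i i.
Proof.
move=> [_ Spos]; rewrite -dot_delta_mx; apply: Spos; apply/eqP => /matrixP/(_ i 0).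
by rewrite !mxE !eqxx => /eqP; rewrite oner_eq0.
Qed.

Lemma spd_offdiag_le n (S : 'M[R]_n) i j : spd S ->
  `|S i j| <= Num.sqrt (S i i) * Num.sqrt (S j j).
Proof.
move=> Sspd; rewrite -ler_sqr ?nnegrE ?mulr_ge0 ?sqrtr_ge0 //.
rewrite real_normK ?num_real // exprMn !sqr_sqrtr ?(ltW (spd_diag_gt0 _ Sspd)) //.
have [Ssym _] := Sspd.
have := psd_cauchy_schwarz (delta_mx i 0) (delta_mx j 0) Ssym
  (fun z => spd_psd z Sspd).
by rewrite !dot_delta_mx.
Qed.

Lemma kappa2_ge1 n (S : 'M[R]_n) (n_gt0 : (0 < n)%N) : spd S -> 1 <= kappa2 S.
Proof.
move=> /(sigma_bounds n_gt0)[m0 mM _ _].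
by rewrite /kappa2 ler_pdivlMr // mul1r.
Qed.

(** Diagonal scaling makes every diagonal entry 1, so the largest singular value
    is at least 1 and the inverse of the smallest is at most the condition
    number. *)
Lemma kappa2S_spec n (B : 'M[R]_n) (n_gt0 : (0 < n)%N) : spd B ->
  1 <= kappa2S B /\
  forall x : 'cV[R]_n, \sum_i B i i * x i 0 ^+ 2 <= kappa2S B * dot x (B *m x).
Proof.
move=> Bspd; have [Bsym Bpos] := Bspd.
have diag i : 0 < B i i by exact: spd_diag_gt0.
have sq i : Num.sqrt (B i i) != 0 by rewrite gt_eqF // sqrtr_gt0.
rewrite /kappa2S; set D := diag_mx _; set S := D *m B *m D.
have Dsym : D^T = D by rewrite tr_diag_mx.
have Squad y : dot y (S *m y) = dot (D *m y) (B *m (D *m y)).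
  by rewrite -[in RHS]Dsym dot_trmx !mulmxA Dsym.
have Dinj (y : 'cV[R]_n) : D *m y = 0 -> y = 0.
  move=> Dy0; apply/colP => i; have /matrixP/(_ i 0)/eqP := Dy0.
  by rewrite mul_diag_mx !mxE mulf_eq0 invr_eq0 (negPf (sq i)) => /eqP.
have Sspd : spd S.
  split=> [|y y0]; first by rewrite !trmx_mul Dsym Bsym mulmxA.
  by rewrite Squad Bpos //; apply: contra_neq y0 => /Dinj.
have kS1 := kappa2_ge1 n_gt0 Sspd; split=> // x.
have [m0 mM lo hi] := sigma_bounds n_gt0 Sspd.
have M1 : 1 <= sigma_max S.
  pose i0 := Ordinal n_gt0.
  have := spd_entry_le i0 i0 n_gt0 Sspd; apply: le_trans.
  have -> : S i0 i0 = 1.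
    rewrite /S mul_mx_diag mul_diag_mx !mxE -{2}(sqr_sqrtr (ltW (diag i0))).
    by field; exact: sq.
  by rewrite normr1.
pose y := \col_i (Num.sqrt (B i i) * x i 0).
have Dy : D *m y = x.
  by apply/colP => i; rewrite mul_diag_mx !mxE mulrA mulVf ?mul1r.
have /andP[qlo _] := spd_quad_bounds y n_gt0 Sspd.
have -> : \sum_i B i i * x i 0 ^+ 2 = dot y y.
  apply: eq_bigr => i _; rewrite !mxE -{1}(sqr_sqrtr (ltW (diag i))).
  by rewrite -expr2 exprMn.
rewrite -Dy -Squad /kappa2 mulrAC ler_pdivlMr // mulrC.
by apply: le_trans qlo _; rewrite ler_peMl // spd_psd.
Qed.

End Condition.

(** * Rounding errors of matrix products *)

Section Rounding.
Variable R : realType.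
Implicit Types (n : nat) (w : R).

Lemma fl_sum_neq0 w s y : fl_sum w s y -> (0 < size s)%N.
Proof.
elim=> // {}s s1 s2 x1 x2 z /perm_size -> _ s1_gt0 _ _ _.
by rewrite size_cat addn_gt0 s1_gt0.
Qed.

(** An addition of two partial sums costs one factor [1 + w] on each of them,
    and neither of them has as many terms as the whole sum. *)
Lemma fl_sum_err w s y : 0 <= w -> fl_sum w s y ->
  `|y - \sum_(x <- s) x| <= ((1 + w) ^+ (size s).-1 - 1) * \sum_(x <- s) `|x|.
Proof.
move=> w0; elim=> [x|{}s s1 s2 x1 x2 z eqs fl1 IH1 fl2 IH2 [d [dw ->]]].
  by rewrite !big_seq1 subrr normr0 expr0 subrr mul0r.
rewrite !(perm_big _ eqs) !big_cat (perm_size eqs) size_cat /=.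
have := fl_sum_neq0 fl1; have := fl_sum_neq0 fl2.
case: (size s1) IH1 => // n1 /= IH1; case: (size s2) IH2 => // n2 /= IH2 _ _.
rewrite addnS /=.
set S1 := \sum_(x <- s1) x in IH1 *; set S2 := \sum_(x <- s2) x in IH2 *.
set T1 := \sum_(x <- s1) _ in IH1 *; set T2 := \sum_(x <- s2) _ in IH2 *.
have T1ge : `|S1| <= T1 by exact: ler_norm_sum.
have T2ge : `|S2| <= T2 by exact: ler_norm_sum.
have T10 : 0 <= T1 by exact: le_trans T1ge.
have T20 : 0 <= T2 by exact: le_trans T2ge.
have w1 : 1 <= 1 + w by lra.
have e1 : (1 + w) * (1 + w) ^+ n1 <= (1 + w) ^+ (n1.+1 + n2).
  by rewrite -exprS; apply: ler_weXn2l => //; rewrite leq_addr.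
have e2 : (1 + w) * (1 + w) ^+ n2 <= (1 + w) ^+ (n1.+1 + n2).
  by rewrite -exprS; apply: ler_weXn2l => //; rewrite addSnnS leq_addl.
move: e1 e2; set e := _ ^+ (_ + _); set f1 := _ ^+ n1 in IH1 *.
set f2 := _ ^+ n2 in IH2 * => e1 e2.
have x1le : `|x1| <= f1 * T1.
  have -> : x1 = (x1 - S1) + S1 by ring.
  by apply: le_trans (ler_normD _ _) _; lra.
have x2le : `|x2| <= f2 * T2.
  have -> : x2 = (x2 - S2) + S2 by ring.
  by apply: le_trans (ler_normD _ _) _; lra.
have -> : (x1 + x2) * (1 + d) - (S1 + S2) = (x1 - S1) + (x2 - S2) + d * (x1 + x2).
  by ring.
have dle : `|d * (x1 + x2)| <= w * (f1 * T1 + f2 * T2).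
  rewrite normrM; apply: ler_pM => //; apply: le_trans (ler_normD _ _) _; lra.
have h1 : (1 + w) * f1 * T1 <= e * T1 by exact: ler_wpM2r.
have h2 : (1 + w) * f2 * T2 <= e * T2 by exact: ler_wpM2r.
apply: le_trans (ler_normD _ _) _; have := ler_normD (x1 - S1) (x2 - S2).
lra.
Qed.

(** Convexity of the power on [[0, 1]]. *)
Lemma expr1Dn_le n w : 0 <= w <= 1 -> (1 + w) ^+ n - 1 <= 2 ^+ n * w.
Proof.
move=> /andP[w0 w1]; suff : (1 + w) ^+ n - 1 <= (2 ^+ n - 1) * w by lra.
elim: n => [|n IH]; first by rewrite !expr0 subrr mul0r.
have := ler_wpM2l (_ : 0 <= 1 + w) IH; rewrite !exprS.
have : 1 <= (2 : R) ^+ n by rewrite exprn_ege1 // ler1n.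
set p := 2 ^+ n; set q := (1 + w) ^+ n => p1 h.
have {}h : (1 + w) * (q - 1) <= (1 + w) * ((p - 1) * w) by apply: h; lra.
have : 0 <= (p - 1) * (w * (1 - w)) by rewrite !mulr_ge0 //; lra.
lra.
Qed.

Lemma fl_mulmx_err m n p w (B : 'M[R]_(m, n)) (C : 'M[R]_(n, p)) P i j :
    0 <= w <= 1 -> fl_mulmx w B C P ->
  `|P i j - (B *m C) i j| <= 2 ^+ n * w * \sum_l `|B i l| * `|C l j|.
Proof.
move=> /andP[w0 w1] /(_ i j)[t [tBC tP]].
set S := \sum_l _ * _.
have n_gt0 : (0 < n)%N by have := fl_sum_neq0 tP; rewrite size_codom card_ord.
have := fl_sum_err w0 tP; rewrite size_codom card_ord !big_image /= => err.
have S0 : 0 <= S by apply: sumr_ge0 => l _; rewrite mulr_ge0.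
have tS : \sum_l `|t l| <= (1 + w) * S.
  rewrite mulr_sumr; apply: ler_sum => l _; have [d [dw ->]] := tBC l.
  rewrite normrM normrM mulrC ler_wpM2r ?mulr_ge0 //.
  by apply: le_trans (ler_normD _ _) _; rewrite normr1 lerD2l.
have tE : `|\sum_l t l - (B *m C) i j| <= w * S.
  rewrite mxE -sumrB; apply: le_trans (ler_norm_sum _ _ _) _.
  rewrite mulr_sumr; apply: ler_sum => l _; have [d [dw ->]] := tBC l.
  have -> : B i l * C l j * (1 + d) - B i l * C l j = d * (B i l * C l j) by ring.
  by rewrite !normrM ler_wpM2r ?mulr_ge0.
have e0 : 0 <= (1 + w) ^+ n.-1 - 1 by rewrite subr_ge0 exprn_ege1 // lerDl.
have h1 := ler_wpM2l e0 tS.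
have h2 : ((1 + w) ^+ n - 1) * S <= 2 ^+ n * w * S.
  by rewrite ler_wpM2r // expr1Dn_le // w0.
have eS : (1 + w) ^+ n = (1 + w) * (1 + w) ^+ n.-1 by rewrite -exprS prednK.
have -> : P i j - (B *m C) i j = (P i j - \sum_l t l) + (\sum_l t l - (B *m C) i j).
  by ring.
apply: le_trans (ler_normD _ _) _; rewrite eS in h2; lra.
Qed.

Lemma fl_mulmx_tr m n p w (B : 'M[R]_(m, n)) (C : 'M[R]_(n, p)) P :
  fl_mulmx w B C P -> fl_mulmx w C^T B^T P^T.
Proof.
move=> fl i j; have [t [tBC tP]] := fl j i.
by exists t; split=> [l|]; rewrite !mxE // mulrC.
Qed.

Lemma sum_mul_le n (f g : 'I_n -> R) b c :
    (forall l, 0 <= f l <= b) -> (forall l, 0 <= g l <= c) ->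
  \sum_l f l * g l <= n%:R * (b * c).
Proof.
move=> fb gc; apply: (@le_trans _ _ (\sum_(l < n) b * c)).
  apply: ler_sum => l _.
  by have /andP[f0 fl] := fb l; have /andP[g0 gl] := gc l; apply: ler_pM.
by rewrite sumr_const card_ord -[_ *+ n]mulr_natl.
Qed.

Lemma mulmx_entry_le m n p (B : 'M[R]_(m, n)) (C : 'M[R]_(n, p)) b c i j :
    (forall i j, `|B i j| <= b) -> (forall i j, `|C i j| <= c) ->
  `|(B *m C) i j| <= n%:R * (b * c).
Proof.
move=> Bb Cc; rewrite mxE; apply: le_trans (ler_norm_sum _ _ _) _.
under eq_bigr do rewrite normrM.
by apply: sum_mul_le => l; rewrite normr_ge0 /=.
Qed.

Lemma fl_mulmx_entry_err m n p w (B : 'M[R]_(m, n)) (C : 'M[R]_(n, p)) P b c i j :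
    0 <= w <= 1 -> (forall i j, `|B i j| <= b) -> (forall i j, `|C i j| <= c) ->
    fl_mulmx w B C P ->
  `|P i j - (B *m C) i j| <= 2 ^+ n * w * (n%:R * (b * c)).
Proof.
move=> w01 Bb Cc /(fl_mulmx_err i j w01) /le_trans; apply.
have /andP[w0 _] := w01.
by rewrite ler_wpM2l ?mulr_ge0 ?exprn_ge0 //;
   apply: sum_mul_le => l; rewrite normr_ge0 /=.
Qed.

(** Products are bounded entrywise through the largest entries of the factors;
    powers of [n] are harmless here. *)
Definition fl_triple_const n : R := 2 ^+ n * (2 ^+ n + 2) * n%:R ^+ 2.

Lemma fl_mulmx3_err n w (B C D Y P : 'M[R]_n) b c d i j :
    0 <= w <= 1 -> (forall i j, `|B i j| <= b) -> (forall i j, `|C i j| <= c) ->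
    (forall i j, `|D i j| <= d) -> fl_mulmx w B C Y -> fl_mulmx w Y D P ->
  `|P i j - (B *m C *m D) i j| <= fl_triple_const n * w * (b * c * d).
Proof.
move=> w01 Bb Cc Dd flY flP; have /andP[w0 w1] := w01.
have nn : 0 <= n%:R :> R by [].
have K0 : 0 <= 2 ^+ n :> R by rewrite exprn_ge0.
have b0 : 0 <= b := le_trans (normr_ge0 _) (Bb i j).
have c0 : 0 <= c := le_trans (normr_ge0 _) (Cc i j).
have d0 : 0 <= d := le_trans (normr_ge0 _) (Dd i j).
set K := 2 ^+ n in K0 *; set N := n%:R in nn *.
have Yerr i' j' : `|(Y - B *m C) i' j'| <= K * w * (N * (b * c)).
  by rewrite mxE [X in _ + X]mxE; apply: fl_mulmx_entry_err.
have Yle i' j' : `|Y i' j'| <= (1 + K * w) * (N * (b * c)).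
  have -> : Y i' j' = (Y - B *m C) i' j' + (B *m C) i' j'.
    by rewrite mxE [X in _ + X + _]mxE subrK.
  rewrite mulrDl mul1r addrC; apply: le_trans (ler_normD _ _) _.
  by apply: lerD => //; apply: mulmx_entry_le.
have Perr := fl_mulmx_entry_err i j w01 Yle Dd flP.
have Eerr := mulmx_entry_le i j Yerr Dd.
have -> : P i j - (B *m C *m D) i j = P i j - (Y *m D) i j + ((Y - B *m C) *m D) i j.
  have -> : ((Y - B *m C) *m D) i j = (Y *m D) i j - (B *m C *m D) i j.
    by rewrite mulmxBl mxE [X in _ + X]mxE.
  ring.
apply: le_trans (ler_normD _ _) _; apply: le_trans (lerD Perr Eerr) _.
rewrite /fl_triple_const -/K -/N.
have h : 0 <= K * K * w * (1 - w) * (N * N * b * c * d).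
  by rewrite !mulr_ge0 ?subr_ge0.
rewrite -subr_ge0; apply: le_trans h _; rewrite le_eqVlt; apply/orP; left.
by apply/eqP; ring.
Qed.

Lemma computed_congruence_err n u uh (A Qt Ac : 'M[R]_n) a q i j :
    let At := Qt^T *m A *m Qt in let e := fl_triple_const n * uh * (q * a * q) in
    0 <= u <= 1 -> 0 <= uh <= 1 -> A^T = A ->
    (forall i j, `|A i j| <= a) -> (forall i j, `|Qt i j| <= q) ->
    computed_congruence u uh A Qt Ac ->
  `|Ac i j - At i j| <= e + u * (`|At i j| + e).
Proof.
move=> At e /andP[u0 u1] uh01 Asym Aa Qq [Y [P [flP _ Acr]]].
have Qq' i' j' : `|Qt^T i' j'| <= q by rewrite mxE.
have Atsym : At^T = At by rewrite !trmx_mul trmxK Asym mulmxA.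
have Perr i' j' : `|P i' j' - At i' j'| <= e.
  case: flP => [[flY flP]|[flY flP]]; first exact: fl_mulmx3_err flY flP.
  (* Transposing turns the product associated to the right into the other one. *)
  have flY' := fl_mulmx_tr flY; have flP' := fl_mulmx_tr flP.
  rewrite trmxK in flP'; rewrite Asym in flY'.
  have := fl_mulmx3_err j' i' uh01 Qq' Aa Qq flY' flP'.
  by rewrite -/At -{1}Atsym !mxE.
have sym (p : R) : `|p - At i j| <= e -> rounded u p (Ac i j) ->
    `|Ac i j - At i j| <= e + u * (`|At i j| + e).
  move=> pe [d [du ->]].
  have -> : p * (1 + d) - At i j = (p - At i j) + d * p by ring.
  apply: le_trans (ler_normD _ _) _; apply: lerD => //.
  rewrite normrM; apply: ler_pM => //.
  have -> : p = At i j + (p - At i j) by ring.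
  by apply: le_trans (ler_normD _ _) _; rewrite lerD2l.
case: (Acr i j) => [|/sym]; first exact: sym.
by apply; have := Perr j i; rewrite -{1}Atsym mxE.
Qed.

End Rounding.

(** * Eigenvalues and eigenvectors under perturbed congruences *)

Section Eigenbasis.
Variable R : realType.
Implicit Type n : nat.

Lemma diag_quad n (V : 'M[R]_n) (a : 'rV[R]_n) x :
  dot x ((V *m diag_mx a *m V^T) *m x) = \sum_j a 0 j * (V^T *m x) j 0 ^+ 2.
Proof.
rewrite -!mulmxA -dot_trmx; apply: eq_bigr => j _.
by rewrite mul_diag_mx [X in _ * X]mxE mulrCA expr2.
Qed.

Lemma sum_coord_sqr n (V : 'M[R]_n) (x : 'cV[R]_n) :
  V^T *m V = 1%:M -> \sum_j (V^T *m x) j 0 ^+ 2 = dot x x.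
Proof.
move=> /mulmx1C VV; rewrite -(@orthogonal_isometry _ _ V^T) ?trmxK //.
Qed.

(** The two families of conditions are those cutting out the spaces that Courant
    and Fischer intersect; their codimensions add up to [n - 1]. *)
Lemma courant_fischer_vector n (r1 r2 : 'M[R]_n) (k : 'I_n) :
  exists2 x : 'cV[R]_n, x != 0 &
    (forall j : 'I_n, (j < k)%N -> (r1 *m x) j 0 = 0) /\
    (forall j : 'I_n, (k < j)%N -> (r2 *m x) j 0 = 0).
Proof.
have [x x0 xr] :=
  nontrivial_solution (\matrix_(i, j) if (i < k)%N then r1 i j else r2 i j) k.
exists x => //; split=> j jk.
  have := xr j; rewrite neq_ltn jk => /(_ isT) <-.
  by rewrite !mxE; apply: eq_bigr => i _; rewrite mxE jk.
have := xr j; rewrite neq_ltn jk orbT => /(_ isT) <-.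
by rewrite !mxE; apply: eq_bigr => i _; rewrite mxE ltnNge ltnW.
Qed.

Definition nonincreasing_row n (a : 'rV[R]_n) :=
  forall i j : 'I_n, (i <= j)%N -> a 0 j <= a 0 i.

Section Weyl.
Variables (n : nat) (V W T : 'M[R]_n) (a m : 'rV[R]_n) (k : 'I_n) (s t r : R).
Hypotheses (VV : V^T *m V = 1%:M) (WW : W^T *m W = 1%:M).
Hypotheses (a_mono : nonincreasing_row a) (m_mono : nonincreasing_row m).
Hypotheses (s_ge0 : 0 <= s) (ak_ge0 : 0 <= a 0 k).
Let A := V *m diag_mx a *m V^T.
Let M := W *m diag_mx m *m W^T.

(** Weyl's inequality for forms compared through a change of variables [T]: on the
    vector of [courant_fischer_vector] the form of [M] is at least its [k]th
    eigenvalue, and the form of [A] at the image is at most the [k]th one. *)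
Lemma weyl_le :
    (forall x, dot x (M *m x) <= s * dot (T *m x) (A *m (T *m x)) + t * dot x x) ->
    (forall x, dot (T *m x) (T *m x) <= r * dot x x) ->
  m 0 k <= s * (r * a 0 k) + t.
Proof.
move=> MA Tr.
have [x x0 [xV xW]] := courant_fischer_vector (V^T *m T) W^T k.
have lo : m 0 k * dot x x <= dot x (M *m x).
  rewrite /M diag_quad -(sum_coord_sqr x WW) mulr_sumr.
  apply: ler_sum => j _; have [/xW ->|jk] := ltnP k j.
    by rewrite expr0n /= !mulr0.
  by apply: ler_wpM2r; rewrite ?sqr_ge0 // m_mono.
have hi : dot (T *m x) (A *m (T *m x)) <= a 0 k * dot (T *m x) (T *m x).
  rewrite /A diag_quad -(sum_coord_sqr (T *m x) VV) mulr_sumr.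
  apply: ler_sum => j _; have [/xV|kj] := ltnP j k.
    by rewrite -mulmxA => ->; rewrite expr0n /= !mulr0.
  by apply: ler_wpM2r; rewrite ?sqr_ge0 // a_mono.
have xx := dot_gt0 x0; rewrite -(ler_pM2r xx).
have h1 := ler_wpM2l ak_ge0 (Tr x).
have h2 := ler_wpM2l s_ge0 (le_trans hi h1).
have := MA x; lra.
Qed.

Lemma weyl_ge :
    (forall x, s * dot (T *m x) (A *m (T *m x)) - t * dot x x <= dot x (M *m x)) ->
    (forall x, r * dot x x <= dot (T *m x) (T *m x)) ->
  s * (r * a 0 k) - t <= m 0 k.
Proof.
move=> MA Tr.
have [x x0 [xW xV]] := courant_fischer_vector W^T (V^T *m T) k.
have hi : dot x (M *m x) <= m 0 k * dot x x.
  rewrite /M diag_quad -(sum_coord_sqr x WW) mulr_sumr.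
  apply: ler_sum => j _; have [/xW ->|jk] := ltnP j k.
    by rewrite expr0n /= !mulr0.
  by apply: ler_wpM2r; rewrite ?sqr_ge0 // m_mono.
have lo : a 0 k * dot (T *m x) (T *m x) <= dot (T *m x) (A *m (T *m x)).
  rewrite /A diag_quad -(sum_coord_sqr (T *m x) VV) mulr_sumr.
  apply: ler_sum => j _; have [/xV|kj] := ltnP k j.
    by rewrite -mulmxA => ->; rewrite expr0n /= !mulr0.
  by apply: ler_wpM2r; rewrite ?sqr_ge0 // a_mono.
have xx := dot_gt0 x0; rewrite -(ler_pM2r xx).
have h1 := ler_wpM2l ak_ge0 (Tr x).
have h2 := ler_wpM2l s_ge0 (le_trans h1 lo).
have := MA x; lra.
Qed.

End Weyl.

(** Simplicity of the spectrum makes eigenvectors for different indices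
    orthogonal; the one with index [k] may be prescribed. *)
Lemma simple_eigenbasis n (A : 'M[R]_n) k v :
    A^T = A -> uniq (eigvals A) -> unit_eigenvector A k v ->
  exists V : 'M[R]_n, [/\ V^T *m V = 1%:M,
    A = V *m diag_mx (\row_j eigval A j) *m V^T & col k V = v].
Proof.
move=> Asym Auniq [Av v1].
have /choice[w wP] j : exists w : 'cV[R]_n,
    [/\ A *m w = eigval A j *: w, norm2 w = 1 & j = k -> w = v].
  have [->|jk] := eqVneq j k; first by exists v.
  have [w Aw w1] := eigvals_root Asym (mem_eigval j Asym).
  by exists w; split=> // /eqP; rewrite (negPf jk).
pose V := \matrix_(i, j) w j i 0.
have colV j : col j V = w j by apply/colP => i; rewrite !mxE.
have VV : V^T *m V = 1%:M.
  apply/matrixP => i j; rewrite !mxE.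
  have -> : \sum_l V^T i l * V l j = dot (w i) (w j).
    by apply: eq_bigr => l _; rewrite !mxE.
  have [Ai wi1 _] := wP i; have [Aj wj1 _] := wP j.
  have [->|ij] := eqVneq i j; first by rewrite -sqr_norm2 wj1 expr1n.
  have : (eigval A i - eigval A j) * dot (w i) (w j) = 0.
    by rewrite mulrBl -dotZl -dotZr -Ai -Aj -dot_trmx Asym subrr.
  move/eqP; rewrite mulf_eq0 subr_eq0 => /orP[|/eqP //].
  by rewrite nth_uniq ?size_eigvals // (inj_eq val_inj) (negPf ij).
exists V; split=> //; last by rewrite colV; have [_ _ ->] := wP k.
have AV : A *m V = V *m diag_mx (\row_j eigval A j).
  apply/matrixP => i j; have [Aj _ _] := wP j.
  have -> : (A *m V) i j = (A *m col j V) i 0.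
    by rewrite colE mulmxA -colE [RHS]mxE.
  by rewrite colV Aj mul_mx_diag !mxE mulrC.
by rewrite -AV -mulmxA (mulmx1C VV) mulmx1.
Qed.

End Eigenbasis.

(** * Perturbation of a single eigenvector *)

Section Perturbation.
Variable R : realType.
Implicit Type n : nat.

(** A bound relative to the diagonal is inherited by the bilinear form, measured
    in any norm that dominates the diagonally weighted one. *)
Lemma scaled_entries_form n (F : 'M[R]_n) (b : 'I_n -> R) (f sy sx : R) (y x : 'cV[R]_n) :
    0 <= f -> (forall i, 0 <= b i) ->
    (forall i j, `|F i j| <= f * (Num.sqrt (b i) * Num.sqrt (b j))) ->
    \sum_i b i * y i 0 ^+ 2 <= sy -> \sum_i b i * x i 0 ^+ 2 <= sx ->
  `|dot y (F *m x)| <= n%:R * f * (Num.sqrt sy * Num.sqrt sx).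
Proof.
move=> f0 b0 Fb ysy xsx.
pose wt (z : 'cV[R]_n) i := Num.sqrt (b i) * `|z i 0|.
have wt0 z i : 0 <= wt z i by rewrite mulr_ge0 ?sqrtr_ge0.
have wt_le (z : 'cV[R]_n) s : \sum_i b i * z i 0 ^+ 2 <= s ->
    \sum_i wt z i <= Num.sqrt n%:R * Num.sqrt s.
  move=> zs.
  have wtE : \sum_i wt z i ^+ 2 = \sum_i b i * z i 0 ^+ 2.
    by apply: eq_bigr => i _; rewrite exprMn sqr_sqrtr // real_normK ?num_real.
  have s0 : 0 <= s.
    by apply: le_trans zs; rewrite -wtE; apply: sumr_ge0 => i _; rewrite sqr_ge0.
  rewrite -ler_sqr ?nnegrE ?mulr_ge0 ?sqrtr_ge0 ?sumr_ge0 //.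
  rewrite exprMn !sqr_sqrtr //; apply: le_trans (sqr_sum_le _) _.
  by rewrite wtE ler_wpM2l.
have Fyx : `|dot y (F *m x)| <= f * ((\sum_i wt y i) * \sum_j wt x j).
  rewrite big_distrlr mulr_sumr; apply: le_trans (ler_norm_sum _ _ _) _.
  apply: ler_sum => i _; rewrite mxE mulr_sumr mulr_sumr.
  apply: le_trans (ler_norm_sum _ _ _) _; apply: ler_sum => j _.
  rewrite !normrM /wt.
  have -> : f * (Num.sqrt (b i) * `|y i 0| * (Num.sqrt (b j) * `|x j 0|)) =
    `|y i 0| * (f * (Num.sqrt (b i) * Num.sqrt (b j)) * `|x j 0|) by ring.
  by apply: ler_wpM2l => //; apply: ler_wpM2r.
apply: le_trans Fyx _; rewrite [n%:R * f]mulrC -mulrA; apply: ler_wpM2l => //.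
have := ler_pM (sumr_ge0 _ (fun i _ => wt0 y i)) (sumr_ge0 _ (fun i _ => wt0 x i))
  (wt_le _ _ ysy) (wt_le _ _ xsx).
by rewrite mulrACA -expr2 sqr_sqrtr.
Qed.

(** A relative gap [g] is measured against the geometric mean of two numbers; it
    bounds the distance from [a] to [b] below in terms of [a] alone, because a
    small [b] is far from [a] anyway. *)
Lemma half_gap (a b g th : R) : 0 < a -> 0 < b -> 0 <= th ->
    g * Num.sqrt (a * b) <= `|a - b| -> th <= g / 4 -> th <= 4^-1 ->
  th * a <= `|a - b| / 2.
Proof.
move=> a0 b0 th0 gap thg th4.
have [ba|ba] := lerP (a / 4) b; last first.
  have h : th * a <= 4^-1 * a by rewrite ler_pM2r.
  by have := ler_norm (a - b); lra.
have sq : a / 2 <= Num.sqrt (a * b).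
  have a2 : 0 <= a / 2 by lra.
  rewrite -(ger0_norm a2) -sqrtr_sqr ler_sqrt ?(mulr_ge0 (ltW a0) (ltW b0)) //.
  have := ler_wpM2l (ltW a0) ba; lra.
have g0 : 0 <= g by lra.
have h1 := ler_wpM2l g0 sq.
have h2 : th * a <= g / 4 * a by rewrite ler_pM2r.
lra.
Qed.

(** [half_gap] for the largest admissible [th], up to a factor. *)
Lemma gap_dominates (a b g : R) : 0 < a -> 0 < b -> 0 < g ->
    g * Num.sqrt (a * b) <= `|a - b| -> a <= 2 * (1 + g^-1) * `|a - b|.
Proof.
move=> a0 b0 g0 gap; have g1 : 0 < g + 1 by lra.
(* Half the harmonic mean of [g / 4] and [1 / 4], hence below both. *)
pose th := g / (4 * (g + 1)).
have th0 : 0 < th by rewrite divr_gt0 // mulr_gt0.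
have thg : th <= g / 4.
  by rewrite /th ler_pM2l // lef_pV2 ?posrE ?mulr_gt0 //; lra.
have th4 : th <= 4^-1 by rewrite /th ler_pdivrMr ?mulr_gt0 //; lra.
have := half_gap a0 b0 (ltW th0) gap thg th4.
rewrite -(ler_pM2l (_ : 0 < th^-1)) ?invr_gt0 // mulKf ?gt_eqF //.
move=> /le_trans; apply; rewrite le_eqVlt; apply/orP; left; apply/eqP.
by rewrite /th; field; rewrite !gt_eqF.
Qed.

Lemma near_isometry n (Q : 'M[R]_n) (p : R) x :
    (forall y, norm2 ((Q^T *m Q - 1%:M) *m y) <= p * norm2 y) ->
  (1 - p) * dot x x <= dot (Q *m x) (Q *m x) <= (1 + p) * dot x x.
Proof.
move=> Qp.
have -> : dot (Q *m x) (Q *m x) = dot x ((Q^T *m Q - 1%:M) *m x) + dot x x.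
  by rewrite mulmxBl mul1mx dotBr subrK -mulmxA -(dot_trmx Q^T) trmxK.
have := abs_dot_le x ((Q^T *m Q - 1%:M) *m x).
have := ler_wpM2l (norm2_ge0 x) (Qp x).
rewrite mulrCA -expr2 sqr_norm2 ler_norml => h1 /andP[h2 h3].
by apply/andP; split; lra.
Qed.

Lemma near_isometry_unit n (Q : 'M[R]_n) (p : R) : p < 1 ->
    (forall y, norm2 ((Q^T *m Q - 1%:M) *m y) <= p * norm2 y) ->
  Q \in unitmx.
Proof.
move=> p1 Qp; rewrite -unitmx_tr unitmxE unitfE; apply/det0P => -[v v0 vQ].
have /andP[lo _] := near_isometry v^T Qp.
have Qv : Q *m v^T = 0 by rewrite -[Q]trmxK -trmx_mul vQ trmx0.
have := dot_gt0 (_ : v^T != 0); rewrite trmx_eq0 => /(_ v0) vv.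
have h : 0 < (1 - p) * dot v^T v^T by rewrite mulr_gt0 // subr_gt0.
by move: lo; rewrite Qv (dotE 0) mulmx0 mxE; lra.
Qed.

Section PerturbedCongruence.
Variables (n : nat) (k : 'I_n) (A Qt F V W : 'M[R]_n) (a m : 'rV[R]_n).
Variables (p e phi c g : R).
Let At := Qt^T *m A *m Qt.
Hypothesis VV : V^T *m V = 1%:M.
Hypothesis WW : W^T *m W = 1%:M.
Hypothesis AE : A = V *m diag_mx a *m V^T.
Hypothesis ME : At + F = W *m diag_mx m *m W^T.
Hypothesis a_mono : nonincreasing_row a.
Hypothesis m_mono : nonincreasing_row m.
Hypothesis a_gt0 : forall j, 0 < a 0 j.
Hypotheses (p_ge0 : 0 <= p) (p_le : p <= 8^-1) (e_ge0 : 0 <= e) (c_ge0 : 0 <= c).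
Hypothesis Q_near : forall x, norm2 ((Qt^T *m Qt - 1%:M) *m x) <= p * norm2 x.
Hypothesis F_rel : forall x y, `|dot y (F *m x)| <=
  e * (Num.sqrt (dot y (At *m y)) * Num.sqrt (dot x (At *m x))).
Hypothesis F_abs : forall x y, `|dot y (F *m x)| <= phi * (norm2 y * norm2 x).
Hypothesis phi_le : forall j, phi <= c * a 0 j.
Hypotheses (g_gt0 : 0 < g) (p_gap : p <= g / 8).
Hypothesis gap : forall j, j != k ->
  g * Num.sqrt (a 0 k * a 0 j) <= `|a 0 k - a 0 j|.
Hypothesis large_or_small : 8 * c <= g \/ e <= g / 16 /\ e <= 16^-1.

Let q := col k W.
Let beta := 2 * c + 4.

Lemma At_quad x : dot x (At *m x) = dot (Qt *m x) (A *m (Qt *m x)).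
Proof. by rewrite /At -!mulmxA -(dot_trmx Qt^T) trmxK. Qed.

Lemma At_quad_ge0 x : 0 <= dot x (At *m x).
Proof.
rewrite At_quad AE diag_quad; apply: sumr_ge0 => j _.
by rewrite mulr_ge0 ?sqr_ge0 // ltW.
Qed.

Lemma F_rel_quad x : `|dot x (F *m x)| <= e * dot x (At *m x).
Proof. by have := F_rel x x; rewrite -expr2 sqr_sqrtr ?At_quad_ge0. Qed.

Lemma F_abs_quad x : `|dot x (F *m x)| <= phi * dot x x.
Proof. by have := F_abs x x; rewrite -expr2 sqr_norm2. Qed.

Lemma perturbed_eigenvector : (At + F) *m q = m 0 k *: q /\ dot q q = 1.
Proof.
by rewrite ME col_eigenvector // dot_col_orthogonal.
Qed.

(** Two regimes. If the gap is large compared with the absolute size of the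
    perturbation, ordinary Weyl bounds suffice; otherwise the relative size [e]
    is small and the relative Weyl bounds do. Neither works throughout: [e] need
    not be below 1 when [g] is large. *)
Lemma perturbed_eigenvalue :
  [/\ forall j, j != k -> `|a 0 k - a 0 j| <= 2 * `|m 0 k - a 0 j|,
      `|m 0 k| <= beta * a 0 k & dot q (At *m q) <= beta * a 0 k].
Proof.
have [Mq qq] := perturbed_eigenvector.
have ak := a_gt0 k.
have qAq : dot q (At *m q) = m 0 k - dot q (F *m q).
  by rewrite -[m 0 k]mulr1 -qq -dotZr -Mq mulmxDl dotDr addrK.
have close j : j != k -> `|m 0 k - a 0 k| <= `|a 0 k - a 0 j| / 2 ->
    `|a 0 k - a 0 j| <= 2 * `|m 0 k - a 0 j|.
  move=> _ h; have := ler_normD (a 0 k - m 0 k) (m 0 k - a 0 j).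
  by rewrite (distrC (a 0 k) (m 0 k)) addrA subrK; lra.
have hi x : dot (Qt *m x) (Qt *m x) <= (1 + p) * dot x x.
  by case/andP: (near_isometry x Q_near).
have lo x : (1 - p) * dot x x <= dot (Qt *m x) (Qt *m x).
  by case/andP: (near_isometry x Q_near).
have p0 := p_ge0; have p8 := p_le; have pg := p_gap.
have e0 := e_ge0; have c0 := c_ge0; have g0 := g_gt0.
case: large_or_small => [gc|[eg e16]].
- have up : m 0 k <= 1 * ((1 + p) * a 0 k) + phi.
    apply: (weyl_le VV WW a_mono m_mono _ (ltW ak) _ hi) => // x.
    rewrite -ME -AE mul1r -At_quad mulmxDl dotDr lerD2l.
    by apply: le_trans (ler_norm _) (F_abs_quad x).
  have down : 1 * ((1 - p) * a 0 k) - phi <= m 0 k.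
    apply: (weyl_ge VV WW a_mono m_mono _ (ltW ak) _ lo) => // x.
    rewrite -ME -AE mul1r -At_quad mulmxDl dotDr lerD2l lerNl.
    by apply: le_trans (ler_norm _) _; rewrite normrN F_abs_quad.
  have mk : `|m 0 k - a 0 k| <= p * a 0 k + phi by rewrite ler_norml; lra.
  have phik := phi_le k.
  have pak : p * a 0 k <= 8^-1 * a 0 k by rewrite ler_pM2r.
  have cak : 0 <= c * a 0 k by rewrite mulr_ge0 // ltW.
  have mle : `|m 0 k| <= (2 + c) * a 0 k.
    by move: mk; rewrite !ler_norml => /andP[? ?]; apply/andP; split; lra.
  split.
  + move=> j jk; apply: close => //; apply: le_trans mk _.
    have aj := a_gt0 j; have gj := gap jk.
    have sq0 : 0 <= Num.sqrt (a 0 k * a 0 j) := sqrtr_ge0 _.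
    (* The smaller of the two eigenvalues is below their geometric mean. *)
    have phis : phi <= c * Num.sqrt (a 0 k * a 0 j).
      have [akj|akj] := lerP (a 0 k) (a 0 j).
        apply: le_trans phik _; rewrite ler_wpM2l //.
        rewrite -{1}(ger0_norm (ltW ak)) -sqrtr_sqr ler_sqrt ?(mulr_ge0 (ltW ak) (ltW aj)) //.
        by rewrite expr2 ler_pM2l.
      apply: le_trans (phi_le j) _; rewrite ler_wpM2l //.
      rewrite -{1}(ger0_norm (ltW aj)) -sqrtr_sqr ler_sqrt ?(mulr_ge0 (ltW ak) (ltW aj)) //.
      by rewrite expr2 ler_pM2r // ltW.
    have h1 := ler_wpM2r sq0 gc.
    have h2 : 2 * p * a 0 k <= `|a 0 k - a 0 j| / 2.
      by apply: (half_gap ak aj _ gj); lra.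
    lra.
  + by rewrite /beta; lra.
  + have := F_abs_quad q; rewrite qq mulr1 => Fq.
    rewrite qAq /beta; move: Fq mle; rewrite !ler_norml => /andP[? ?] /andP[? ?].
    lra.
- have e1 : 0 <= 1 + e by lra.
  have e1' : 0 <= 1 - e by lra.
  have up : m 0 k <= (1 + e) * ((1 + p) * a 0 k) + 0.
    apply: (weyl_le VV WW a_mono m_mono _ (ltW ak) _ hi) => // x.
    rewrite -ME -AE -At_quad mulmxDl dotDr mul0r addr0.
    by have := F_rel_quad x; rewrite ler_norml => /andP[_ ?]; lra.
  have down : (1 - e) * ((1 - p) * a 0 k) - 0 <= m 0 k.
    apply: (weyl_ge VV WW a_mono m_mono _ (ltW ak) _ lo) => // x.
    rewrite -ME -AE -At_quad mulmxDl dotDr mul0r subr0.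
    by have := F_rel_quad x; rewrite ler_norml => /andP[? _]; lra.
  have ea : 0 <= e * a 0 k by rewrite mulr_ge0 // ltW.
  have epa0 : 0 <= e * (p * a 0 k) by rewrite !mulr_ge0 // ltW.
  have epa : e * (p * a 0 k) <= e * a 0 k.
    by rewrite ler_wpM2l // ger_pMl //; lra.
  have mk : `|m 0 k - a 0 k| <= (p + 2 * e) * a 0 k.
    by rewrite ler_norml; apply/andP; split; lra.
  have pea : (p + 2 * e) * a 0 k <= 4^-1 * a 0 k by rewrite ler_pM2r //; lra.
  have mle : `|m 0 k| <= 2 * a 0 k.
    by move: mk; rewrite !ler_norml => /andP[? ?]; apply/andP; split; lra.
  have cak : 0 <= c * a 0 k by rewrite mulr_ge0 // ltW.
  split.
  + move=> j jk; apply: close => //; apply: le_trans mk _.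
    by apply: (half_gap ak (a_gt0 j) _ (gap jk)); lra.
  + by rewrite /beta; lra.
  + have q0 := At_quad_ge0 q; have := F_rel_quad q.
    have h3 : e * dot q (At *m q) <= 16^-1 * dot q (At *m q) by rewrite ler_wpM2r.
    move: mle; rewrite !ler_norml => /andP[_ h1] /andP[h2 _].
    have -> : beta * a 0 k = 2 * (c * a 0 k) + 4 * a 0 k by rewrite /beta; ring.
    clear up down mk pea epa epa0; lra.
Qed.

(** Testing the eigenvalue equation for [q] against [b] with [Qt *m b] an
    eigenvector of [A]: the defect of orthogonality of [Qt] and the perturbation
    [F] appear separately, and each is divided by the gap. *)
Lemma perturbed_coordinate j : j != k ->
  `|(V^T *m (Qt *m q)) j 0| <= 8 * beta * p * (1 + g^-1) + 2 * beta * e / g.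
Proof.
move=> jk; have [Mq qq] := perturbed_eigenvector.
have [sep mle qle] := perturbed_eigenvalue.
have aj := a_gt0 j; have ak := a_gt0 k; have gj := gap jk.
have p0 := p_ge0; have p8 := p_le; have e0 := e_ge0.
have c0 := c_ge0; have g0 := g_gt0.
have betage : 4 <= beta by rewrite /beta; lra.
pose v := col j V; pose b := invmx Qt *m v.
have Qb : Qt *m b = v.
  rewrite mulKVmx //.
  by apply: near_isometry_unit Q_near; lra.
have Av : A *m v = a 0 j *: v by rewrite AE col_eigenvector.
have vv : dot v v = 1 by exact: dot_col_orthogonal.
have Asym : A^T = A by rewrite AE !trmx_mul trmxK tr_diag_mx mulmxA.
rewrite coord_trmx -/v; set x := dot v _.
set G := Qt^T *m Qt - 1%:M.
have resid : (a 0 j - m 0 k) * x = - (m 0 k * dot b (G *m q)) - dot b (F *m q).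
  have E1 : a 0 j * x = dot b (At *m q).
    by rewrite /x -dotZl -Av -{1}Asym dot_trmx -Qb -[in LHS]dot_trmx -[in RHS]mulmxA
      -[in RHS]mulmxA dot_trmx -(dot_trmx Qt^T) trmxK.
  have E2 : dot b (At *m q) = m 0 k * dot b q - dot b (F *m q).
    by rewrite -dotZr -Mq mulmxDl dotDr addrK.
  have E3 : dot b (G *m q) = x - dot b q.
    by rewrite /G mulmxBl mul1mx dotBr -mulmxA -(dot_trmx Qt^T) trmxK Qb.
  by rewrite mulrBl E1 E2 E3; ring.
have bb : norm2 b <= 2.
  rewrite -ler_sqr ?nnegrE ?norm2_ge0 // sqr_norm2.
  have /andP[lo _] := near_isometry b Q_near; rewrite Qb vv in lo.
  have h : 2^-1 * dot b b <= (1 - p) * dot b b.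
    by rewrite ler_wpM2r ?dot_ge0 //; lra.
  lra.
have nq : norm2 q = 1 by rewrite /norm2 qq sqrtr1.
have Gle : `|dot b (G *m q)| <= 2 * p.
  apply: le_trans (abs_dot_le _ _) _; apply: ler_pM; rewrite ?norm2_ge0 //.
  by have := Q_near q; rewrite nq mulr1.
have bAb : dot b (At *m b) = a 0 j by rewrite At_quad Qb Av dotZr vv mulr1.
set s := Num.sqrt (a 0 k * a 0 j) in gj.
have Fle : `|dot b (F *m q)| <= e * (beta * s).
  apply: le_trans (F_rel q b) _; rewrite ler_wpM2l // bAb.
  rewrite /s mulrC sqrtrM ?(ltW ak) // mulrA ler_wpM2r ?sqrtr_ge0 //.
  have bk0 : 0 <= beta * a 0 k by rewrite mulr_ge0 //; lra.
  apply: (@le_trans _ _ (Num.sqrt (beta * a 0 k))); first by rewrite ler_sqrt.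
  rewrite sqrtrM; last lra.
  rewrite ler_wpM2r ?sqrtr_ge0 //.
  have b0 : 0 <= beta by lra.
  rewrite -{2}(ger0_norm b0) -sqrtr_sqr ler_sqrt ?sqr_ge0 // expr2.
  by rewrite ler_peMl //; lra.
have main : `|a 0 k - a 0 j| * `|x| <=
    2 * (beta * a 0 k * (2 * p) + e * (beta * s)).
  apply: (@le_trans _ _ (2 * `|(a 0 j - m 0 k) * x|)).
    by rewrite normrM mulrA ler_wpM2r // (distrC (a 0 j)) sep.
  rewrite ler_pM2l // resid; apply: le_trans (ler_normB _ _) _.
  by rewrite normrN normrM; apply: lerD => //; apply: ler_pM.
have gapk := gap_dominates ak aj g_gt0 gj.
set D := `|a 0 k - a 0 j| in main gj gapk.
have s_gt0 : 0 < s by rewrite sqrtr_gt0 mulr_gt0.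
have D0 : 0 < D by apply: lt_le_trans gj; rewrite mulr_gt0.
have sD : s <= D / g by rewrite ler_pdivlMr // mulrC.
rewrite -(ler_pM2l D0); apply: le_trans main _.
have h1 : 4 * beta * p * a 0 k <= 4 * beta * p * (2 * (1 + g^-1) * D).
  by rewrite ler_wpM2l // !mulr_ge0 //; lra.
have h2 : 2 * beta * e * s <= 2 * beta * e * (D / g).
  by rewrite ler_wpM2l // !mulr_ge0 //; lra.
lra.
Qed.

End PerturbedCongruence.

End Perturbation.

(** * From entrywise errors to the computed eigenvector *)

Section ComputedVector.
Variable R : realType.
Implicit Type n : nat.

Lemma sin_angle_mul n (v x : 'cV[R]_n) : norm2 v = 1 -> x != 0 ->
  sin (angle v x) * norm2 x = norm2 (x - dot v x *: v).
Proof.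
move=> v1 x0; have nx := norm2_gt0 x0.
have vv : dot v v = 1 by rewrite -sqr_norm2 v1 expr1n.
rewrite /angle v1 mul1r; set c := _ / _.
have c0 : 0 <= c by rewrite divr_ge0 // norm2_ge0.
have c1 : c <= 1.
  by rewrite ler_pdivrMr // mul1r -[norm2 x]mul1r -v1 abs_dot_le.
rewrite sin_acos; last by rewrite c1 andbT; lra.
rewrite -[X in _ * X](ger0_norm (ltW nx)) -sqrtr_sqr -sqrtrM; last first.
  by rewrite subr_ge0 -(expr1n _ 2) ler_sqr ?nnegrE.
congr Num.sqrt.
have cx : c ^+ 2 * norm2 x ^+ 2 = dot v x ^+ 2.
  by rewrite -exprMn divfK ?gt_eqF // real_normK ?num_real.
rewrite mulrBl mul1r cx sqr_norm2 dotBl !dotBr !dotZl !dotZr vv (dotC x v).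
ring.
Qed.

(** Projecting off the direction of [v] turns the sine into a norm, which
    tolerates the error [x - w]. *)
Lemma sin_angle_bound n (V : 'M[R]_n) k (w x : 'cV[R]_n) (B r : R) :
    V^T *m V = 1%:M -> 0 <= B ->
    (forall j, j != k -> `|(V^T *m w) j 0| <= B) ->
    norm2 (x - w) <= r -> 2^-1 <= norm2 x ->
  sin (angle (col k V) x) <= 2 * (n%:R * B + r).
Proof.
move=> VV B0 wB xw x2; set v := col k V.
have vv : dot v v = 1 by exact: dot_col_orthogonal.
have v1 : norm2 v = 1 by rewrite /norm2 vv sqrtr1.
have x0 : x != 0.
  by apply/eqP => x0; move: x2; rewrite x0 norm2_0; lra.
have VVt := mulmx1C VV.
have iso y : norm2 (V^T *m y) = norm2 y.
  by rewrite /norm2 orthogonal_isometry // trmxK.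
have wle : norm2 (w - dot v w *: v) <= n%:R * B.
  rewrite -iso; apply: norm2_le_bound => // j.
  have vj : dot (col j V) v = (j == k)%:R.
    by rewrite -coord_trmx /v colE mulmxA VV mul1mx mxE eqxx andbT.
  rewrite coord_trmx dotBr dotZr vj; have [->|jk] := eqVneq j k.
    by rewrite -/v mulr1 subrr normr0.
  by rewrite mulr0 subr0 -coord_trmx wB.
have rle : norm2 ((x - w) - dot v (x - w) *: v) <= r.
  apply: le_trans xw; rewrite -ler_sqr ?nnegrE ?norm2_ge0 // !sqr_norm2.
  move: (x - w) => y; rewrite dotBl !dotBr !dotZl !dotZr vv (dotC y v).
  have := sqr_ge0 (dot v y); rewrite expr2; lra.
have : sin (angle v x) * norm2 x <= n%:R * B + r.
  rewrite sin_angle_mul //.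
  have -> : x - dot v x *: v =
      (w - dot v w *: v) + ((x - w) - dot v (x - w) *: v).
    rewrite dotBr scalerBl !opprB; apply/colP => i; rewrite !mxE; ring.
  by apply: le_trans (norm2D _ _) _; apply: lerD.
have s0 : 0 <= sin (angle v x).
  by rewrite -(pmulr_lge0 _ (norm2_gt0 x0)) sin_angle_mul // norm2_ge0.
have := ler_wpM2l s0 x2; lra.
Qed.

Lemma spd_congruence n (A Q : 'M[R]_n) :
  spd A -> Q \in unitmx -> spd (Q^T *m A *m Q).
Proof.
move=> [Asym Apos] Qu; split=> [|x x0].
  by rewrite !trmx_mul trmxK Asym mulmxA.
rewrite -!mulmxA -(dot_trmx Q^T) trmxK; apply: Apos.
by apply: contra_neq x0 => Qx; rewrite -(mulKmx Qu x) Qx mulmx0.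
Qed.

(** [2 * p8] comes from the backward error of the eigensolver, whose constant [p7]
    is at most [p8] and whose scaling by the diagonal of [Ac] costs a factor 2. *)
Definition entry_const n (p8 : R) : R := 16 * fl_triple_const R n + 1 + 2 * p8.

Lemma fl_triple_const_ge0 n : 0 <= fl_triple_const R n.
Proof. by rewrite /fl_triple_const !mulr_ge0 ?addr_ge0 ?exprn_ge0. Qed.

Section Scaled.
Variables (n : nat) (p1 p5 p7 p8 u uh : R) (A Qt Ac QJh : 'M[R]_n).
Variable Lh : 'rV[R]_n.
Let At := Qt^T *m A *m Qt.
Hypotheses (n_gt0 : (0 < n)%N) (Aspd : spd A).
Hypotheses (uh_gt0 : 0 < uh) (uh_lt : uh < u) (u_le1 : u <= 1).
Hypothesis p_le : p1 * u <= 8^-1.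
Hypothesis Q_near : forall x,
  norm2 ((Qt^T *m Qt - 1%:M) *m x) <= p1 * u * norm2 x.
Hypothesis uh_small : uh * sigma_max A <= u * sigma_min A.

Lemma near_isometry2 x : norm2 (Qt *m x) <= 2 * norm2 x.
Proof.
have pu := p_le; have /andP[_ hi] := near_isometry x Q_near.
rewrite -ler_sqr ?nnegrE ?mulr_ge0 ?norm2_ge0 // exprMn !sqr_norm2.
by apply: le_trans hi _; rewrite ler_wpM2r ?dot_ge0 //; lra.
Qed.

Lemma near_isometry_entry i j : `|Qt i j| <= 2.
Proof.
apply: le_trans (entry_le_norm_col _ _ _) _.
by have := near_isometry2 (delta_mx j 0); rewrite norm2_delta mulr1.
Qed.

Lemma At_spd : spd At.
Proof.
apply: spd_congruence => //; apply: near_isometry_unit Q_near.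
by have := p_le; lra.
Qed.

Lemma At_diag_bounds i : sigma_min A <= 2 * At i i /\ At i i <= 2 * sigma_max A.
Proof.
have pu := p_le; have [m0 mM _ _] := sigma_bounds n_gt0 Aspd.
have -> : At i i = dot (Qt *m delta_mx i 0) (A *m (Qt *m delta_mx i 0)).
  by rewrite -dot_delta_mx /At -!mulmxA -(dot_trmx Qt^T) trmxK.
have := near_isometry (delta_mx i 0) Q_near; rewrite dot_delta !mulr1.
have := spd_quad_bounds (Qt *m delta_mx i 0) n_gt0 Aspd.
set y := Qt *m _; set X := dot y y; set Y := dot y (A *m y) => /andP[lo hi] /andP[Xlo Xhi].
have h1 : sigma_min A * 2^-1 <= sigma_min A * X by rewrite ler_pM2l //; lra.
have h2 : sigma_max A * X <= sigma_max A * 2.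
  by rewrite ler_pM2l ?(lt_le_trans m0) //; lra.
by split; lra.
Qed.

(** The errors of the products are small relative to the norm of [A]; since the
    roundoff [uh] is below [u] by a factor of the condition number, they are
    of order [u] relative to its smallest eigenvalue, hence relative to every
    diagonal entry of [At]. *)
Lemma computed_congruence_scaled i j :
    computed_congruence u uh A Qt Ac ->
  `|Ac i j - At i j| <= (16 * fl_triple_const R n + 1) * u *
    (Num.sqrt (At i i) * Num.sqrt (At j j)).
Proof.
move=> cc; have u1 := u_le1; have uh0 := uh_gt0; have uhu := uh_lt.
have u01 : 0 <= u <= 1 by lra.
have uh01 : 0 <= uh <= 1 by lra.
have [Asym _] := Aspd.
have := computed_congruence_err i j u01 uh01 Asym
  (fun i j => spd_entry_le i j n_gt0 Aspd) near_isometry_entry cc.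
rewrite -/At; set T := fl_triple_const R n.
have T0 : 0 <= T := fl_triple_const_ge0 n.
set s := Num.sqrt _ * Num.sqrt _.
have Ats : `|At i j| <= s := spd_offdiag_le i j At_spd.
have s0 : 0 <= s by rewrite mulr_ge0 ?sqrtr_ge0.
have [m0 mM _ _] := sigma_bounds n_gt0 Aspd.
have ms : sigma_min A <= 2 * s.
  have m2 : 0 <= sigma_min A / 2 by lra.
  have : sigma_min A / 2 <= s.
    rewrite /s -sqrtrM ?(ltW (spd_diag_gt0 _ At_spd)) //.
    rewrite -(ger0_norm m2) -sqrtr_sqr ler_sqrt ?mulr_ge0 ?(ltW (spd_diag_gt0 _ At_spd)) //.
    have [hi _] := At_diag_bounds i; have [hj _] := At_diag_bounds j.
    by rewrite expr2; apply: ler_pM => //; lra.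
  lra.
set e := T * uh * _.
have es : e <= 8 * T * u * s.
  have h1 := ler_wpM2l (_ : 0 <= 4 * T) uh_small.
  have h2 := ler_wpM2l (_ : 0 <= 4 * T * u) ms.
  have {}h1 : 4 * T * (uh * sigma_max A) <= 4 * T * (u * sigma_min A).
    by apply: h1; rewrite mulr_ge0.
  have {}h2 : 4 * T * u * sigma_min A <= 4 * T * u * (2 * s).
    by apply: h2; rewrite !mulr_ge0 //; lra.
  rewrite /e; lra.
move=> /le_trans; apply.
have h3 : u * (`|At i j| + e) <= u * (s + 8 * T * u * s).
  by rewrite ler_wpM2l //; [lra | apply: lerD].
have h4 : u * (8 * T * u * s) <= 1 * (8 * T * u * s).
  by rewrite ler_wpM2r // !mulr_ge0 //; lra.
lra.
Qed.

(** The rounding errors and the backward error of the eigensolver together: the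
    computed decomposition is exact for a matrix that is entrywise close to [At]
    relative to its diagonal. *)
Lemma backward_error_scaled (DA : 'M[R]_n) i j :
    computed_congruence u uh A Qt Ac ->
    p7 + 2 * p7 * u + 2 <= p8 -> entry_const n p8 * u <= 1 -> 0 <= p8 ->
    (forall i j, `|DA i j| <= p7 * u * Num.sqrt (Ac i i * Ac j j)) ->
  `|(Ac + DA - At) i j| <= entry_const n p8 * u *
    (Num.sqrt (At i i) * Num.sqrt (At j j)).
Proof.
move=> cc p78 cu p80 DAle.
have uh0 := uh_gt0; have uhu := uh_lt; have u0 : 0 < u by lra.
have pos i' : 0 < At i' i' := spd_diag_gt0 i' At_spd.
move: cu; rewrite /entry_const; set T := fl_triple_const R n => cu.
have T0 : 0 <= T := fl_triple_const_ge0 n.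
have p8u : 0 <= p8 * u by rewrite mulr_ge0 ?(ltW u0).
have Acd i' : `|Ac i' i' - At i' i'| <= (16 * T + 1) * u * At i' i'.
  have := computed_congruence_scaled i' i' cc.
  by rewrite -expr2 sqr_sqrtr ?(ltW (pos _)).
have Acb i' : 0 <= Ac i' i' /\ Ac i' i' <= 2 * At i' i'.
  have h : (16 * T + 1) * u * At i' i' <= 1 * At i' i'.
    by rewrite ler_pM2r //; lra.
  by have := Acd i'; rewrite ler_norml => /andP[? ?]; split; lra.
have sAc i' j' : Num.sqrt (Ac i' i' * Ac j' j') <=
    2 * (Num.sqrt (At i' i') * Num.sqrt (At j' j')).
  have [a0 a2] := Acb i'; have [b0 b2] := Acb j'.
  rewrite -ler_sqr ?nnegrE ?mulr_ge0 ?sqrtr_ge0 // sqr_sqrtr ?mulr_ge0 //.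
  rewrite !exprMn !sqr_sqrtr ?(ltW (pos _)) // expr2 mulrACA.
  by apply: ler_pM.
set s := Num.sqrt (At i i) * _.
have s0 : 0 <= s by rewrite mulr_ge0 ?sqrtr_ge0.
have DAs : `|DA i j| <= 2 * p8 * u * s.
  have [p70|p70] := lerP 0 p7; last first.
    apply: le_trans (DAle i j) _; apply: (@le_trans _ _ 0).
      by rewrite mulr_le0_ge0 ?sqrtr_ge0 // mulr_le0_ge0 ?(ltW p70) ?(ltW u0).
    by rewrite !mulr_ge0 ?(ltW u0).
  apply: le_trans (DAle i j) _.
  have p7u : 0 <= p7 * u by rewrite mulr_ge0 ?(ltW u0).
  apply: (@le_trans _ _ (p7 * u * (2 * s))); first by rewrite ler_wpM2l // sAc.
  have h : p7 * (u * s) <= p8 * (u * s).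
    by rewrite ler_wpM2r ?mulr_ge0 ?(ltW u0) //; lra.
  lra.
have -> : (Ac + DA - At) i j = (Ac i j - At i j) + DA i j by rewrite !mxE; ring.
apply: le_trans (ler_normD _ _) _.
by have := computed_congruence_scaled i j cc; rewrite -/T -/s; lra.
Qed.

(** The relative bound measures the forms by [At] and pays the scaled condition
    number; the absolute one measures them by the identity. *)
Lemma perturbation_forms (F : 'M[R]_n) f : 0 <= f ->
    (forall i j, `|F i j| <= f * (Num.sqrt (At i i) * Num.sqrt (At j j))) ->
  (forall x y, `|dot y (F *m x)| <= n%:R * f * kappa2S At *
    (Num.sqrt (dot y (At *m y)) * Num.sqrt (dot x (At *m x)))) /\
  (forall x y, `|dot y (F *m x)| <= n%:R * f * (2 * sigma_max A) * (norm2 y * norm2 x)).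
Proof.
move=> f0 Fle; have diag_ge0 i : 0 <= At i i := ltW (spd_diag_gt0 i At_spd).
have [kS1 kSq] := kappa2S_spec n_gt0 At_spd.
have [m0 mM _ _] := sigma_bounds n_gt0 Aspd.
have kS0 : 0 <= kappa2S At := le_trans ler01 kS1.
have M0 : 0 <= 2 * sigma_max A by lra.
move: (kappa2S At) kSq kS0 => kS kSq kS0.
have wt (z : 'cV[R]_n) : \sum_i At i i * z i 0 ^+ 2 <= 2 * sigma_max A * dot z z.
  rewrite mulr_sumr; apply: ler_sum => i _; rewrite -expr2 ler_wpM2r ?sqr_ge0 //.
  by have [] := At_diag_bounds i.
split=> x y.
  have := scaled_entries_form f0 diag_ge0 Fle (kSq y) (kSq x).
  move/le_trans; apply; rewrite !(sqrtrM _ kS0).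
  rewrite [X in _ * X]mulrACA -expr2 (sqr_sqrtr kS0).
  by rewrite -[X in _ <= X]mulrA.
have := scaled_entries_form f0 diag_ge0 Fle (wt y) (wt x).
move/le_trans; apply; rewrite !(sqrtrM _ M0).
by rewrite [X in _ * X]mulrACA -expr2 (sqr_sqrtr M0) -[X in _ <= X]mulrA.
Qed.

Definition apply_const m (b : R) : R := 4 * 2 ^+ m * m%:R ^+ 2 + 2 * b.

(** The error in [xh] is amplified by at most 2, and the rounded product adds an
    error of order [u]; with [b = p5] this is the constant [apply_const]. *)
Lemma computed_product_err (x xh vh : 'cV[R]_n) :
    norm2 x = 1 -> norm2 (xh - x) <= p5 * u -> p5 * u <= 1 ->
    fl_mulmx u Qt xh vh ->
  norm2 (vh - Qt *m x) <= apply_const n p5 * u.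
Proof.
move=> x1 xhx p5u fl; have uh0 := uh_gt0; have uhu := uh_lt.
have u01 : 0 <= u <= 1 by have := u_le1; lra.
have xh2 : norm2 xh <= 2.
  have -> : xh = (xh - x) + x by rewrite subrK.
  by apply: le_trans (norm2D _ _) _; rewrite x1; lra.
have xhe i j : `|xh i j| <= 2.
  by rewrite ord1; apply: le_trans (abs_coord_le _ _) _.
have -> : vh - Qt *m x = (vh - Qt *m xh) + Qt *m (xh - x).
  by rewrite mulmxBr addrA subrK.
apply: le_trans (norm2D _ _) _.
have h1 : norm2 (vh - Qt *m xh) <= n%:R * (2 ^+ n * u * (n%:R * (2 * 2))).
  apply: norm2_le_bound => [|i].
    by rewrite !mulr_ge0 ?exprn_ge0 //; case/andP: u01.
  rewrite mxE [X in _ + X]mxE.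
  exact: fl_mulmx_entry_err u01 near_isometry_entry xhe fl.
have h2 := near_isometry2 (xh - x).
rewrite /apply_const; lra.
Qed.

End Scaled.

End ComputedVector.

(** * Choice of the constant *)

Section Assembly.
Variable R : realType.
Implicit Type n : nat.

Definition form_const n (p8 : R) : R := n%:R * entry_const n p8.

Definition coord_const n (p1 p8 : R) : R :=
  let c := form_const n p8 in 8 * (2 * c + 4) * p1 + 2 * (2 * c + 4) * c.

(** [2 * (n * coord_const) + 2 * apply_const] is what the sine is bounded with; the
    surplus makes the bound exceed 1 unless [u] and [u * kS / g] are small enough
    for the perturbation argument, as [smallness] spells out. *)
Definition sin_const n (p1 p5 p8 : R) : R :=
  2 * (n%:R * coord_const n p1 p8) + 6 * apply_const n p5 + 8 * p1 + p5 +
  16 * form_const n p8 + 128 * form_const n p8 ^+ 2 + 2 * n%:R.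

Lemma powR_ge1 n (x : R) : (0 < n)%N -> 0 <= x -> 1 <= n%:R `^ x.
Proof.
move=> n0 x0; have n1 : 1 <= n%:R :> R by rewrite ler1n.
by have := ler_powR n1 x0; rewrite powRr0.
Qed.

(** Errors of order [uh] relative to the norm of [A] are of order [u] relative to
    its smallest eigenvalue. *)
Lemma uh_sigma_max_le n (A : 'M[R]_n) (u uh p : R) :
    (0 < n)%N -> spd A -> 0 < uh -> uh < u -> n%:R * u <= 2^-1 -> 0 <= p -> p < 1 ->
    gamma_ n uh < u * (1 - p) / (16 * n%:R `^ (1 / 2) * kappa2 A) ->
  uh * sigma_max A <= u * sigma_min A.
Proof.
move=> n0 Aspd uh0 uhu nu p0 p1 gam.
have [m0 mM _ _] := sigma_bounds n0 Aspd.
have k1 := kappa2_ge1 n0 Aspd.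
have n1 : 1 <= n%:R :> R by rewrite ler1n.
have nh : 1 <= n%:R `^ (1 / 2) :> R by apply: powR_ge1.
have uhg : uh <= gamma_ n uh.
  have a : uh <= n%:R * uh by rewrite ler_peMl // ltW.
  have b : n%:R * uh < n%:R * u by rewrite ltr_pM2l // ltr0n.
  have d : 0 < 1 - n%:R * uh by lra.
  rewrite /gamma_ ler_pdivlMr //; apply: (le_trans _ a).
  by rewrite ler_piMr ?(ltW uh0) //; lra.
have rhs : u * (1 - p) / (16 * n%:R `^ (1 / 2) * kappa2 A) <= u / kappa2 A.
  have k0 : 0 < kappa2 A by lra.
  have q0 : 0 < 16 * n%:R `^ (1 / 2) :> R by rewrite mulr_gt0 //; lra.
  rewrite invfM mulrA ler_pM2r ?invr_gt0 // ler_pdivrMr //.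
  have u0 : 0 <= u by lra.
  by apply: ler_wpM2l => //; lra.
have : uh <= u / kappa2 A by lra.
by rewrite /kappa2 invf_div mulrA ler_pdivlMr // (lt_le_trans m0).
Qed.

(** Perturbations of order [u] relative to the norm of [A] stay comparable with its
    smallest eigenvalue. *)
Lemma u_sigma_max_le n (A : 'M[R]_n) (u p : R) :
    (0 < n)%N -> spd A -> 0 < u -> 0 <= p -> p < 1 ->
    10 * n%:R `^ (3 / 2) * u * (1 - p)^-1 * kappa2 A < 1 ->
  10 * (u * sigma_max A) <= sigma_min A.
Proof.
move=> n0 Aspd u0 p0 p1 h.
have [m0 mM _ _] := sigma_bounds n0 Aspd.
have k1 := kappa2_ge1 n0 Aspd.
have nh : 1 <= n%:R `^ (3 / 2) :> R by apply: powR_ge1 => //; lra.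
have q1 : 1 <= (1 - p)^-1 by rewrite invf_ge1; lra.
have : 10 * u * kappa2 A <= 1.
  apply: le_trans (ltW h); rewrite ler_wpM2r; [by []|lra|].
  have a : 10 * u <= 10 * n%:R `^ (3 / 2) * u.
    by rewrite ler_wpM2r ?(ltW u0) //; lra.
  by apply: le_trans a _; rewrite ler_peMr // !mulr_ge0 ?(ltW u0) //; lra.
by rewrite /kappa2 mulrA ler_pdivrMr // mul1r mulrA.
Qed.

Lemma spd_eigval_ge n (A : 'M[R]_n) j :
  (0 < n)%N -> spd A -> sigma_min A <= eigval A j.
Proof.
move=> n0 Aspd; have [Asym _] := Aspd.
have [x Ax x1] := eigvals_root Asym (mem_eigval j Asym).
have xx : dot x x = 1 by rewrite -sqr_norm2 x1 expr1n.
have /andP[+ _] := spd_quad_bounds x n0 Aspd.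
by rewrite Ax dotZr xx !mulr1.
Qed.

Section Constants.
Variables (n : nat) (p1 p5 p8 : R).
Hypotheses (n_gt0 : (0 < n)%N) (p1_ge0 : 0 <= p1) (p5_ge0 : 0 <= p5) (p8_ge0 : 0 <= p8).
Let c := form_const n p8.
Let B := coord_const n p1 p8.
Let rho := apply_const n p5.

Lemma entry_const_ge1 : 1 <= entry_const n p8.
Proof.
by have T0 := fl_triple_const_ge0 R n; have p0 := p8_ge0; rewrite /entry_const; lra.
Qed.

Lemma entry_const_le : entry_const n p8 <= c.
Proof.
by rewrite /c /form_const ler_peMl ?ler1n // (le_trans ler01) ?entry_const_ge1.
Qed.

Lemma form_const_ge1 : 1 <= c.
Proof. exact: le_trans entry_const_ge1 entry_const_le. Qed.

Lemma coord_const_ge0 : 0 <= B.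
Proof.
have c0 : 0 <= form_const n p8 := le_trans ler01 form_const_ge1.
by rewrite /B /coord_const; move: (form_const n p8) c0 => d d0; rewrite
  addr_ge0 // !mulr_ge0 //; lra.
Qed.

Lemma apply_const_ge0 : 0 <= rho.
Proof. by rewrite /rho /apply_const addr_ge0 // !mulr_ge0 ?exprn_ge0. Qed.

Lemma sin_const_ge0 : 0 <= sin_const n p1 p5 p8.
Proof.
have nB0 : 0 <= n%:R * B by rewrite mulr_ge0 // coord_const_ge0.
have r0 := apply_const_ge0; have c1 := form_const_ge1; have c2 := sqr_ge0 c.
have p10 := p1_ge0; have p50 := p5_ge0; have nn : 0 <= n%:R :> R by [].
have -> : sin_const n p1 p5 p8 = 2 * (n%:R * B) + 6 * rho + 8 * p1 + p5 +
  16 * c + 128 * c ^+ 2 + 2 * n%:R by [].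
lra.
Qed.

Variables (u kS g : R).
Hypotheses (u_gt0 : 0 < u) (kS_ge1 : 1 <= kS) (g_gt0 : 0 < g).
Let eta := u * (1 + kS / g).

Lemma le_eta : u <= eta.
Proof.
have u0 := ltW u_gt0; rewrite /eta ler_peMr // lerDl divr_ge0 ?(ltW g_gt0) //.
exact: le_trans ler01 kS_ge1.
Qed.

Lemma gap_le_eta : u * (kS / g) <= eta.
Proof. by rewrite /eta ler_pM2l // lerDr. Qed.

Lemma inv_gap_le_eta : u * (1 + g^-1) <= eta.
Proof.
rewrite /eta ler_pM2l // lerD2l -[X in X <= _]mul1r.
by rewrite ler_wpM2r // invr_ge0 ltW.
Qed.

Lemma coord_eta_le :
  8 * (2 * c + 4) * (p1 * u) * (1 + g^-1) + 2 * (2 * c + 4) * (c * u * kS) / g <= B * eta.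
Proof.
have c0 : 0 <= c := le_trans ler01 form_const_ge1.
have p10 := p1_ge0.
have b0 : 0 <= 2 * c + 4 by lra.
have h1 : 8 * (2 * c + 4) * p1 * (u * (1 + g^-1)) <= 8 * (2 * c + 4) * p1 * eta.
  by apply: ler_wpM2l inv_gap_le_eta; rewrite mulr_ge0 // mulr_ge0.
have h2 : 2 * (2 * c + 4) * c * (u * (kS / g)) <= 2 * (2 * c + 4) * c * eta.
  by apply: ler_wpM2l gap_le_eta; rewrite mulr_ge0 // mulr_ge0.
rewrite /B /coord_const -/c; lra.
Qed.

Hypothesis small : sin_const n p1 p5 p8 * eta < 1.

Lemma part_eta_le d : 0 <= d -> d <= sin_const n p1 p5 p8 -> d * u <= 1 /\ d * (u * kS) <= g.
Proof.
move=> d0 dC; have eta0 : 0 <= eta := le_trans (ltW u_gt0) le_eta.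
have deta : d * eta <= 1.
  by apply: le_trans (ltW small); rewrite ler_wpM2r.
split; first by apply: le_trans deta; rewrite ler_wpM2l // le_eta.
rewrite -[g]mul1r -ler_pdivrMr // -!mulrA; apply: le_trans deta.
by rewrite ler_wpM2l // gap_le_eta.
Qed.

(** The regimes of the perturbation argument: a gap beyond the absolute size of
    the perturbation, or else a relative size that is small together with its
    quotient by the gap. *)
Lemma smallness :
  [/\ u <= 1, p1 * u <= 8^-1, entry_const n p8 * u <= 1 & n%:R * u <= 2^-1] /\
  [/\ p5 * u <= 1, rho * u <= 6^-1, p1 * u <= g / 8 &
      8 * c <= g \/ c * u * kS <= g / 16 /\ c * u * kS <= 16^-1].
Proof.
have CE : sin_const n p1 p5 p8 = 2 * (n%:R * B) + 6 * rho + 8 * p1 + p5 +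
  16 * c + 128 * c ^+ 2 + 2 * n%:R by [].
have part := part_eta_le; rewrite CE in part.
have nB0 : 0 <= n%:R * B by rewrite mulr_ge0 // coord_const_ge0.
have n0 : 0 <= n%:R :> R by [].
have p10 := p1_ge0; have p50 := p5_ge0; have k1 := kS_ge1; have u0 := u_gt0.
have r0 := apply_const_ge0; have c1 := form_const_ge1.
have ec := entry_const_le; have e1 := entry_const_ge1; have c2 := sqr_ge0 c.
have cc : c * 1 <= c ^+ 2 by rewrite expr2 ler_pM2l //; lra.
have [u1 _] := part 1 (ltac:(lra)) (ltac:(lra)).
have [ecu _] := part (entry_const n p8) (ltac:(lra)) (ltac:(lra)).
have [nu _] := part (2 * n%:R) (ltac:(lra)) (ltac:(lra)).
have [pu pg] := part (8 * p1) (ltac:(lra)) (ltac:(lra)).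
have [p5u _] := part p5 (ltac:(lra)) (ltac:(lra)).
have [ru _] := part (6 * rho) (ltac:(lra)) (ltac:(lra)).
have [_ cg] := part (16 * c) (ltac:(lra)) (ltac:(lra)).
have [_ ccg] := part (128 * c ^+ 2) (ltac:(lra)) (ltac:(lra)).
clear part CE; split; first by split; lra.
split; [lra|lra| |].
  have : 8 * p1 * (u * 1) <= 8 * p1 * (u * kS).
    by rewrite !(ler_wpM2l, mulr_ge0) //; lra.
  lra.
have [|gc] := lerP (8 * c) g; [by left|right; split; first by lra].
(* [u * kS] is small only relative to [g], which is now below [8 * c]. *)
have : 8 * c * (16 * (c * u * kS)) <= 8 * c * 1.
  have -> : 8 * c * (16 * (c * u * kS)) = 128 * c ^+ 2 * (u * kS) by ring.
  lra.
by rewrite ler_pM2l; lra.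
Qed.

End Constants.

End Assembly.
(** * The error bound *)

Section Main.
Variable R : realType.

(** The bound for an arbitrary positive lower bound [g] of the relative gaps, so
    that it also covers the case of no other eigenvalue. *)
Lemma sin_angle_core n (p1 p5 p7 p8 u uh g : R) (A Qt Ac QJh : 'M[R]_n)
    (Lh : 'rV[R]_n) (k : 'I_n) (v vh : 'cV[R]_n) :
    let At := Qt^T *m A *m Qt in
    0 < uh -> uh < u -> spd A ->
    opnorm2 (Qt^T *m Qt - 1%:M) <= p1 * u -> p1 * u < 2^-1 ->
    p7 + 2 * p7 * u + 2 <= p8 -> 0 <= p8 ->
    computed_congruence u uh A Qt Ac -> jacobi_output p5 p7 u Ac QJh Lh ->
    10 * n%:R `^ (3 / 2) * u * (1 - p1 * u)^-1 * kappa2 A < 1 ->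
    gamma_ n uh < u * (1 - p1 * u) / (16 * n%:R `^ (1 / 2) * kappa2 A) ->
    uniq (eigvals A) -> 0 < g ->
    (forall j, j != k -> g * Num.sqrt (eigval A k * eigval A j)
      <= `|eigval A k - eigval A j|) ->
    unit_eigenvector A k v -> fl_mulmx u Qt (col k QJh) vh ->
  sin (angle v vh) <= sin_const n p1 p5 p8 * (u * (1 + kappa2S At / g)).
Proof.
move=> At uh0 uhu Aspd Qp pu2 p78 p80 cc [Lmono [DA [QJ [QJo ME _ QJhe DAe]]]].
move=> cond1 cond2 Auniq g0 gap vk flv.
have n0 : (0 < n)%N := leq_ltn_trans (leq0n k) (ltn_ord k).
have u0 : 0 < u := lt_trans uh0 uhu.
have pu0 : 0 <= p1 * u := le_trans (opnorm2_ge0 _) Qp.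
have p10 : 0 <= p1 by rewrite -(pmulr_lge0 _ u0).
have p50 : 0 <= p5 by rewrite -(pmulr_lge0 _ u0) (le_trans (opnorm2_ge0 _) QJhe).
have pu1 : p1 * u < 1 by lra.
have Qnear x : norm2 ((Qt^T *m Qt - 1%:M) *m x) <= p1 * u * norm2 x.
  by apply: le_trans (norm2_mulmx_le _ _) _; rewrite ler_wpM2r ?norm2_ge0.
have Qu : Qt \in unitmx := near_isometry_unit pu1 Qnear.
have [kS1 _] := kappa2S_spec n0 (spd_congruence Aspd Qu).
rewrite -/At in kS1.
set eta := u * (1 + _ / g).
(* Only a right-hand side below 1 needs an argument. *)
have [big|small] := lerP 1 (sin_const n p1 p5 p8 * eta).
  exact: le_trans (sin_le1 _) big.
have [[u1 p8le cu nu] [p5u rhou pg regime]] :=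
  smallness n0 p10 p50 p80 u0 kS1 g0 small.
have uhs := uh_sigma_max_le n0 Aspd uh0 uhu nu pu0 pu1 cond2.
have us := u_sigma_max_le n0 Aspd u0 pu0 pu1 cond1.
have [m0 mM _ _] := sigma_bounds n0 Aspd.
have [Asym _] := Aspd.
have [V [VV AE colV]] := simple_eigenbasis Asym Auniq vk.
set a := \row_j _ in AE.
have aE j : a 0 j = eigval A j by rewrite mxE.
have a_mono : nonincreasing_row a by move=> i j ij; rewrite !aE eigval_nonincr.
have a_ge j : sigma_min A <= a 0 j by rewrite aE spd_eigval_ge.
have a_gt0 j : 0 < a 0 j := lt_le_trans m0 (a_ge j).
have a_gap j : j != k -> g * Num.sqrt (a 0 k * a 0 j) <= `|a 0 k - a 0 j|.
  by rewrite !aE; apply: gap.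
pose F := Ac + DA - At.
have Fle i j := backward_error_scaled n0 Aspd uh0 uhu u1 p8le Qnear uhs i j
  cc p78 cu p80 DAe.
have e0 : 0 <= entry_const n p8 := le_trans ler01 (entry_const_ge1 n p80).
have [] := perturbation_forms n0 Aspd p8le Qnear (mulr_ge0 e0 (ltW u0)) Fle.
set c := form_const n p8.
have -> : n%:R * (entry_const n p8 * u) = c * u by rewrite mulrA.
rewrite -/At -/F => Frel Fabs.
have c1 : 1 <= c := form_const_ge1 n0 p80.
have c0 : 0 <= c := le_trans ler01 c1.
have ME' : At + F = QJ *m diag_mx Lh *m QJ^T by rewrite -ME /F addrC subrK.
have phile j : c * u * (2 * sigma_max A) <= c * a 0 j.
  rewrite -mulrA ler_wpM2l //; apply: le_trans (a_ge j); apply: le_trans us.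
  have : 0 <= u * sigma_max A by rewrite mulr_ge0 ?(ltW u0) // (le_trans (ltW m0)).
  by clear; lra.
have erel0 : 0 <= c * u * kappa2S At.
  by rewrite mulr_ge0 ?(le_trans ler01 kS1) // mulr_ge0 // ltW.
have coordB j : j != k -> `|(V^T *m (Qt *m col k QJ)) j 0| <= coord_const n p1 p8 * eta.
  move=> jk; apply: le_trans (coord_eta_le n0 p10 p80 u0 kS1 g0).
  have := perturbed_coordinate VV QJo AE ME' a_mono Lmono a_gt0
    pu0 p8le erel0 c0 Qnear Frel Fabs phile g0 pg a_gap regime jk.
  exact.
have nq : norm2 (col k QJ) = 1.
  by rewrite /norm2 dot_col_orthogonal // sqrtr1.
have qhe : norm2 (col k QJh - col k QJ) <= p5 * u.
  have -> : col k QJh - col k QJ = (QJh - QJ) *m delta_mx k 0.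
    by rewrite mulmxBl -!colE.
  apply: le_trans (norm2_mulmx_le _ _) _.
  by rewrite norm2_delta mulr1.
have rerr := computed_product_err uh0 uhu u1 p8le Qnear nq qhe p5u flv.
have wge : 3 / 4 <= norm2 (Qt *m col k QJ).
  have q0 : 0 <= 3 / 4 :> R by clear; lra.
  rewrite -ler_sqr ?nnegrE ?norm2_ge0 ?q0 // sqr_norm2.
  have /andP[+ _] := near_isometry (col k QJ) Qnear.
  rewrite -sqr_norm2 nq expr1n mulr1 expr2; apply: le_trans.
  by move: p8le; clear; lra.
have vge : 2^-1 <= norm2 vh.
  have := norm2B vh (vh - Qt *m col k QJ).
  rewrite opprB addrC subrK; move: wge rerr rhou; clear; lra.
have eta0 : 0 <= eta := le_trans (ltW u0) (le_eta u0 kS1 g0).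
have B0 := coord_const_ge0 n0 p10 p80.
have := sin_angle_bound VV (mulr_ge0 B0 eta0) coordB rerr vge.
rewrite colV => /le_trans; apply.
have rho0 := apply_const_ge0 n p50.
have h4 : apply_const n p5 * u <= apply_const n p5 * eta.
  by rewrite ler_wpM2l // le_eta.
have c2 := sqr_ge0 c.
have h5 : (2 * (n%:R * coord_const n p1 p8) + 2 * apply_const n p5) * eta
    <= sin_const n p1 p5 p8 * eta.
  have n1 : 0 <= n%:R :> R by [].
  rewrite ler_wpM2r // /sin_const -/c.
  by move: rho0 p10 p50 c0 c2 n1; clear; lra.
by move: h4 h5; clear; lra.
Qed.

Lemma evrg_le n (A : 'M[R]_n) (k j : 'I_n) : j != k ->
  (evrg A k <=
    (`|eigval A k - eigval A j| / Num.sqrt (eigval A k * eigval A j))%:E)%E.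
Proof. by move=> jk; apply: bigmin_le_cond. Qed.

End Main.

Theorem theorem3p2 (R : realType) :
  exists p10 : nat -> R -> R -> R -> R,
  forall (n : nat) (p1 p5 p7 p8 u uh : R) (A Qt Ac QJh : 'M[R]_n)
    (Lh : 'rV[R]_n),
  let At := Qt^T *m A *m Qt in
  0 < uh -> uh < u ->
  spd A ->
  opnorm2 (Qt^T *m Qt - 1%:M) <= p1 * u -> p1 * u < 2^-1 ->
  p7 + 2 * p7 * u + 2 <= p8 ->
  computed_congruence u uh A Qt Ac ->
  jacobi_output p5 p7 u Ac QJh Lh ->
  gamma_ n uh < gamma_ n u -> gamma_ n u < 1 ->
  10 * n%:R `^ (3 / 2) * u * (1 - p1 * u)^-1 * kappa2 A < 1 ->
  gamma_ n uh < u * (1 - p1 * u) / (16 * n%:R `^ (1 / 2) * kappa2 A) ->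
  14 * n%:R * u * kappa2S At < 1 ->
  simple_positive_spectrum A ->
  simple_positive_spectrum At ->
  simple_positive_spectrum Ac ->
  forall (k : 'I_n) (v vh : 'cV[R]_n),
  ((p1 * u)%:E * (1 + 2%:E / evrg A k) <= (2^-1)%:E)%E ->
  ((4 * n%:R * (1 + p1 * u) * p8 * u)%:E <= evrg A k)%E ->
  unit_eigenvector A k v ->
  fl_mulmx u Qt (col k QJh) vh ->
  ((sin (angle v vh))%:E <=
    (p10 n p1 p5 p8 * u)%:E * (1 + (kappa2S At)%:E / evrg A k))%E.
Proof.
exists (fun n p1 p5 p8 => 2 * sin_const n p1 p5 p8).
move=> n p1 p5 p7 p8 u uh A Qt Ac QJh Lh At uh0 uhu Aspd Qp pu2 p78 cc jac _ _
  cond1 cond2 _ [Auniq Apos] _ [_ Acpos] k v vh _ evrg_ge vk flv.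
have n0 : (0 < n)%N := leq_ltn_trans (leq0n k) (ltn_ord k).
have u0 : 0 < u := lt_trans uh0 uhu.
have pu0 : 0 <= p1 * u := le_trans (opnorm2_ge0 _) Qp.
have Ac_kk : 0 < Ac k k.
  have [_ [_ [_ Acsym _]]] := cc.
  have /andP[+ _] := rayleigh_bounds (delta_mx k 0) Acsym.
  rewrite dot_delta_mx; apply: lt_le_trans; apply: mulr_gt0.
    apply: Acpos; rewrite -nth_last mem_nth // size_eigvals // prednK //.
  by rewrite dot_delta.
have p70 : 0 <= p7.
  have [_ [DA [QJ [_ _ _ _ DAe]]]] := jac.
  have := le_trans (normr_ge0 _) (DAe k k).
  by rewrite -mulrA pmulr_lge0 // mulr_gt0 // sqrtr_gt0 mulr_gt0.
have p82 : 2 <= p8.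
  have := mulr_ge0 p70 (ltW u0); move: p70 p78; clear; lra.
have p80 : 0 <= p8 by move: p82; clear; lra.
have p10 : 0 <= p1 by rewrite -(pmulr_lge0 _ u0).
have p50 : 0 <= p5.
  have [_ [DA [QJ [_ _ _ QJhe _]]]] := jac.
  by rewrite -(pmulr_lge0 _ u0) (le_trans (opnorm2_ge0 _) QJhe).
have C0 := sin_const_ge0 n0 p10 p50 p80.
have core g := @sin_angle_core R n p1 p5 p7 p8 u uh g A Qt Ac QJh Lh k v vh
  uh0 uhu Aspd Qp pu2 p78 p80 cc jac cond1 cond2 Auniq.
rewrite -/At in core.
have Qu : Qt \in unitmx.
  apply: (@near_isometry_unit _ _ _ (p1 * u)); first by move: pu2; clear; lra.
  by move=> x; apply: le_trans (norm2_mulmx_le _ _) _; rewrite ler_wpM2r ?norm2_ge0.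
have [kS1 _] := kappa2S_spec n0 (spd_congruence Aspd Qu).
rewrite -/At in kS1.
have kS0 : 0 < kappa2S At := lt_le_trans ltr01 kS1.
have lam_gt0 j : 0 < eigval A j by apply: Apos; apply: mem_eigval; case: Aspd.
have gap_pos j : 0 < Num.sqrt (eigval A k * eigval A j).
  by rewrite sqrtr_gt0 mulr_gt0.
have := @evrg_le R n A k; move: evrg_ge; case: (evrg A k) => [g||] // gge glow.
- have g0 : 0 < g.
    apply: lt_le_trans (_ : 4 * n%:R * (1 + p1 * u) * p8 * u <= g); last first.
      by rewrite -lee_fin.
    rewrite !mulr_gt0 ?ltr0n //; first by move: pu0; clear; lra.
    by move: p82; clear; lra.
  have bound := core g g0 _ vk flv.
  have {}bound : sin (angle v vh) <= sin_const n p1 p5 p8 * (u * (1 + kappa2S At / g)).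
    apply: bound => j jk; rewrite -ler_pdivlMr //.
    by rewrite -lee_fin glow.
  have -> : (1 + (kappa2S At)%:E / g%:E = (1 + kappa2S At / g)%:E :> \bar R)%E.
    by rewrite inver gt_eqF.
  rewrite -EFinM lee_fin; apply: le_trans bound _.
  have q0 : 0 <= kappa2S At / g by rewrite divr_ge0 ?(ltW g0) ?(ltW kS0).
  move: (kappa2S At / g) q0 => q q0.
  have -> : 2 * sin_const n p1 p5 p8 * u * (1 + q) =
    2 * (sin_const n p1 p5 p8 * (u * (1 + q))) by ring.
  apply: ler_peMl; last by rewrite ler1n.
  by apply: mulr_ge0 => //; apply: mulr_ge0; [exact: ltW | rewrite addr_ge0].
(* An infinite gap means that there is no other eigenvalue; then every [g] is
   admissible, and the choice [g = kappa] makes the quotient 1, whence the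
   factor 2 in the constant. *)
- have vac j : j != k -> kappa2S At * Num.sqrt (eigval A k * eigval A j)
      <= `|eigval A k - eigval A j|.
    by move=> jk; have := glow j jk; rewrite leye_eq.
  have := core _ kS0 vac vk flv; rewrite divff ?gt_eqF //.
  rewrite invey mule0 adde0 mule1 lee_fin => /le_trans; apply.
  by rewrite le_eqVlt; apply/orP; left; apply/eqP; ring.
Qed.
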